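(* Let $d_0,d_1,d_2$ be non-negative integers with $d_0+d_1+d_2\ge1$ and let $b,\ell,k,r$ be positive integers. Put $d=d_0+d_1+d_2$. Then there exists a positive integer $n_0$ with the following property. For every finite alphabet $\Lambda$ of cardinality $\ell$, every integer $n\ge n_0$, every partition $\mathbf{D}=(D_0,D_1,D_2)$ of $[d]$ with $|D_i|=d_i$ for $i=0,1,2$ and every $r$-coloring $c$ of $\mathrm{W}^{\mathbf{D}}(b,n,\Lambda)$, there exists $\big((f_i)_{i=1}^d,(X_i)_{i\in D_1}\big)$ in $\mathrm{W}^{\mathbf{D}}_v(b,n,\Lambda)$ generating a $k$-dimensional $c$-good combinatorial subspace.
   Context: Trees. For positive integers $b,n$, $b^n$, $b^{<n}$ and $b^{\le n}$ are the sets of finite sequences with entries in $\{0,\dots,b-1\}$ of length exactly $n$, less than $n$, at most $n$. $|s|$ is the length of $s$, $s(i)$ its $i$-th entry, $s^\frown(i)$ is $s$ extended by the entry $i$, $\sqsubseteq$ is the initial segment ordering (strict version $\sqsubset$). $s\le_{\mathrm{lex}}t$ iff either $s\sqsubseteq t$, or $s,t$ are $\sqsubseteq$-incomparable and $s(i)<t(i)$ where $i$ is the length of their longest common initial segment. A subtree is a subset $S$ ordered by $\sqsubseteq$. For $s\in S$: $\mathrm{Pred}_S(s)=\{t\in S:t\sqsubset s\}$, $\mathrm{h}_S(s)=|\mathrm{Pred}_S(s)|$, $\mathrm{ImSucc}_S(s)$ is the set of $t\in S$ with $s\sqsubset t$ and no $t'\in S$ with $s\sqsubset t'\sqsubset t$;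 $S(m)=\{s\in S:\mathrm{h}_S(s)=m\}$. A $k$-complete skew subtree is a subtree $S$ such that: (i) $S$ has a $\sqsubseteq$-minimum and every maximal chain of $S$ has cardinality $k$; (ii) $\mathrm{h}_S(s)=\mathrm{h}_S(s')$ and $s\le_{\mathrm{lex}}s'$ imply $|s|\le|s'|$; (iii) $\mathrm{h}_S(s)<\mathrm{h}_S(s')$ implies $|s|<|s'|$; (iv) for every non-maximal $s\in S$ and $i\in\{0,\dots,b-1\}$ there is a unique $t\in\mathrm{ImSucc}_S(s)$ with $s^\frown(i)\sqsubseteq t$. A vector $k$-complete skew subtree of the $d$-tuple $(b^{<n},\dots,b^{<n})$ is a tuple $(S_1,\dots,S_d)$ of $k$-complete skew subtrees of $b^{<n}$ such that: for $1\le i<j\le d$, $0\le m<k$, $s_i\in S_i(m)$, $s_j\in S_j(m)$ we have $|s_i|\le|s_j|$; and for $0\le m<k-1$, $s\in\bigcup_iS_i(m)$, $s'\in\bigcup_iS_i(m+1)$ we have $|s|<|s'|$. Words. Let $\Lambda$ be a finite alphabet, $(v_t)_{t\in b^{<n}}$ distinct symbols not in $\Lambda$. $\mathrm{W}(b,n,\Lambda)$ is the set of all maps $b^{<n}\to\Lambda$. For a $k$-complete skew subtree $T$ of $b^{<n}$, a $T$-variable word is a map $f:b^{<n}\to\Lambda\cup\{v_t:t\in T\}$ such that for each $t\in T$ the set $f^{-1}(v_t)$ is nonempty with $\sqsubseteq$-minimum $t$; write $\mathrm{ws}(f)=T$, $\mathrm{h}(f)=k$. A variable word is a $T$-variable word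 for some such $k,T$. $[f]_\Lambda\subseteq\mathrm{W}(b,n,\Lambda)$ is the set of all words obtained from $f$ by replacing, for each $t\in\mathrm{ws}(f)$, all occurrences of $v_t$ by a letter $\alpha_t\in\Lambda$ (the letters being arbitrary). Mixed products. $[d]=\{1,\dots,d\}$; parts of a partition may be empty. For a partition $\mathbf{D}=(D_0,D_1,D_2)$ of $[d]$, $\mathrm{W}^{\mathbf{D}}(b,n,\Lambda)$ is the set of triples $((w_i)_{i\in[d]},(x_i)_{i\in D_1},(t_i)_{i\in D_2})$ with $w_i\in\mathrm{W}(b,n,\Lambda)$, $x_i\in b^n$, $t_i\in b^{<n}$. $\mathrm{W}^{\mathbf{D}}_v(b,n,\Lambda)$ is the set of pairs $((f_i)_{i=1}^d,(X_i)_{i\in D_1})$ where each $f_i$ is a variable word, $(\mathrm{ws}(f_i))_{i=1}^d$ is a vector $k$-complete skew subtree for some $k$, and for $i\in D_1$, $X_i\subseteq b^n$ has cardinality $b^{\mathrm{h}(f_i)}$ and $\mathrm{ws}(f_i)\cup X_i$ is an $(\mathrm{h}(f_i)+1)$-complete skew subtree of $b^{\le n}$. The combinatorial subspace generated by such a pair, denoted $[((f_i)_{i=1}^d,(X_i)_{i\in D_1})]_\Lambda$, is the set of triples $((w_i)_{i\in[d]},(x_i)_{i\in D_1},(t_i)_{i\in D_2})$ with $w_i\in[f_i]_\Lambda$, $x_i\in X_i$, $t_i\in\mathrm{ws}(f_i)$; its dimension is $\mathrm{h}(f_1)$ (the common height $k$). Given a finite coloring $c$ of $\mathrm{W}^{\mathbf{D}}(b,n,\Lambda)$,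 the combinatorial subspace is $c$-good if any two of its elements $((w_i),(x_i),(t_i))$ and $((w_i'),(x_i'),(t_i'))$ with $t_i=t_i'$ and $w_i(t_i)=w_i'(t_i')$ for all $i\in D_2$ have the same $c$-color. An $r$-coloring is a map into a set with $r$ elements. *)

(* Defs.v *)
From mathcomp Require Import all_boot all_order finmap.
Set Implicit Arguments. Unset Strict Implicit. Unset Printing Implicit Defensive.
Import Order.TTheory.
Local Open Scope fset_scope.
Local Open Scope nat_scope.

Section Trees.

Variable b : nat.
Implicit Types (s t : seq 'I_b) (S C : {fset seq 'I_b}).

Definition sprefix s t := prefix s t && (s != t).

(* Length of the longest common initial segment. *)
Fixpoint lcp_size s t : nat :=
  match s, t with
  | x :: s', y :: t' => if x == y then (lcp_size s' t').+1 else 0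
  | _, _ => 0
  end.

(* The default 0 of [nth] is never reached: for incomparable [s] and [t],
   [lcp_size s t] is smaller than both lengths. *)
Definition lex_le s t :=
  prefix s t ||
  [&& ~~ prefix s t, ~~ prefix t s &
      let i := lcp_size s t in
      nth 0 (map val s) i < nth 0 (map val t) i].

Lemma lex_leE s t : lex_le s t = (s <= t :> seqlexi 'I_b)%O.
Proof.
elim: s t => [|x s IHs] [|y t] //.
rewrite Order.SeqLexiOrder.lexi_cons -IHs /lex_le /= (eq_sym y x).
case: (x =P y) => [<-|/eqP nxy]; first by rewrite lexx.
rewrite !leEord /=; move: nxy; rewrite -val_eqE /=; case: ltngtP => //.
Qed.

Definition pred_in S s := [fset t in S | sprefix t s].

Definition height_in S s := #|` pred_in S s|.

Definition imsucc S s :=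
  [fset t in S | sprefix s t && ~~ has (fun u => sprefix s u && sprefix u t) S].

Definition level S m := [fset s in S | height_in S s == m].

Definition is_chain C := {in C &, forall s t, prefix s t || prefix t s}.

Definition is_max_chain S C :=
  [/\ C `<=` S, is_chain C &
      forall C', C' `<=` S -> is_chain C' -> C `<=` C' -> C' = C].

Definition complete_skew (k : nat) S : Prop :=
  [/\ (exists2 s0, s0 \in S & {in S, forall s, prefix s0 s}) /\
        (forall C, is_max_chain S C -> #|` C| = k),
      {in S &, forall s s', height_in S s = height_in S s' ->
                            lex_le s s' -> size s <= size s'},
      {in S &, forall s s', height_in S s < height_in S s' -> size s < size s'} &
      {in S, forall s, (exists2 u, u \in S & sprefix s u) ->
        forall i : 'I_b, exists! t, t \in imsucc S s /\ prefix (rcons s i) t}].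

Definition complete_skew_lt (k n : nat) S :=
  complete_skew k S /\ {in S, forall s, size s < n}.

Definition complete_skew_le (k n : nat) S :=
  complete_skew k S /\ {in S, forall s, size s <= n}.

Definition vector_complete_skew (k n d : nat) (S : 'I_d -> {fset seq 'I_b}) : Prop :=
  [/\ forall i, complete_skew_lt k n (S i),
      forall (i j : 'I_d) m si sj, i < j -> m < k ->
        si \in level (S i) m -> sj \in level (S j) m -> size si <= size sj &
      forall (i j : 'I_d) m s s', m.+1 < k ->
        s \in level (S i) m -> s' \in level (S j) m.+1 -> size s < size s'].

End Trees.

(* The set b^{<n}. *)
Definition node (b n : nat) := {t : n.-bseq 'I_b | size t < n}.

Definition node_seq b n (t : node b n) : seq 'I_b := val (val t).

Section Words.

Variables (b n : nat) (Lambda : finType).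

Definition word := {ffun node b n -> Lambda}.

(* A map into Lambda together with all the symbols v_t: [inr t] stands for v_t. *)
Definition preword := {ffun node b n -> Lambda + node b n}.

Definition ws (f : preword) : {fset seq 'I_b} :=
  [fset node_seq t | t in [pred t | [exists s, f s == inr t]]].

Definition variable_word (k : nat) (T : {fset seq 'I_b}) (f : preword) : Prop :=
  [/\ complete_skew_lt k n T,
      forall s t : node b n, f s = inr t -> node_seq t \in T &
      forall t : node b n, node_seq t \in T ->
        f t = inr t /\ (forall s, f s = inr t -> prefix (node_seq t) (node_seq s))].

Lemma mem_ws (f : preword) (t : node b n) :
  reflect (exists s, f s = inr t) (node_seq t \in ws f).
Proof.
apply: (iffP (imfsetP _ _ _ _)) => [[u /= /existsP[s /eqP fs] tu]|[s fs]]; last first.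
  by exists t => //=; apply/existsP; exists s; apply/eqP.
by exists s; rewrite fs; congr inr; apply/val_inj/val_inj.
Qed.

Lemma variable_word_ws k T f : variable_word k T f -> ws f = T.
Proof.
case=> [[_ Tn] fT Tf]; apply/fsetP => s; apply/idP/idP.
  by case/imfsetP => t /= /existsP[u /eqP fu] ->; apply: fT fu.
move=> sT; have sn := Tn s sT.
pose t : node b n := exist _ (Bseq (ltnW sn)) sn.
have -> : s = node_seq t by [].
by apply/mem_ws; exists t; case: (Tf t sT).
Qed.

(* The letters [alpha t] with [t] outside [ws f] play no role. *)
Definition subst_word (f : preword) (alpha : node b n -> Lambda) : word :=
  [ffun s => match f s with inl a => a | inr t => alpha t end].

Definition word_span (f : preword) (w : word) : Prop :=
  exists alpha, w = subst_word f alpha.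

End Words.

(* Parts are allowed to be empty. *)
Definition partition3 (d : nat) (D0 D1 D2 : {set 'I_d}) : bool :=
  [&& (D0 :|: D1 :|: D2 == setT)%SET, [disjoint D0 & D1],
      [disjoint D0 & D2] & [disjoint D1 & D2]].

Section MixedProducts.

Variables (b n d : nat) (Lambda : finType) (D1 D2 : {set 'I_d}).

Definition mixed_word : finType :=
  ({ffun 'I_d -> word b n Lambda} *
   {ffun {i : 'I_d | i \in D1} -> n.-tuple 'I_b} *
   {ffun {i : 'I_d | i \in D2} -> node b n})%type.

Definition mixed_preword :=
  ({ffun 'I_d -> preword b n Lambda} *
   {ffun {i : 'I_d | i \in D1} -> {set n.-tuple 'I_b}})%type.

(* Since k is determined by a k-complete skew subtree, it is the dimension
   of the subspace generated by [F]. *)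
Definition mixed_variable_word (k : nat) (F : mixed_preword) : Prop :=
  let: (f, X) := F in
  [/\ forall i, variable_word k (ws (f i)) (f i),
      vector_complete_skew k n (fun i => ws (f i)) &
      forall i : {i : 'I_d | i \in D1},
        #|X i| = b ^ k /\
        complete_skew_le k.+1 n
          (ws (f (val i)) `|` [fset tval x | x in X i])].

Definition mixed_span (F : mixed_preword) (p : mixed_word) : Prop :=
  let: (f, X) := F in
  let: (w, x, t) := p in
  [/\ forall i, word_span (f i) (w i),
      forall i, x i \in X i &
      forall i, node_seq (t i) \in ws (f (val i))].

Definition good (Col : Type) (c : mixed_word -> Col) (F : mixed_preword) : Prop :=
  forall (p p' : mixed_word), mixed_span F p -> mixed_span F p' ->
    let: (w, _, t) := p in
    let: (w', _, t') := p' in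
    (forall i : {i : 'I_d | i \in D2},
        t i = t' i /\ w (val i) (t i) = w' (val i) (t' i)) ->
    c p = c p'.

End MixedProducts.

(* Main.v *)
Require Import Defs.
From mathcomp Require Import all_boot all_order finmap.
From Stdlib Require Import FunctionalExtensionality.
Set Implicit Arguments. Unset Strict Implicit. Unset Printing Implicit Defensive.
Local Open Scope fset_scope.
Local Open Scope nat_scope.

(** Every step stabilises a colouring from the top of the tree downwards: the
    levels are cut into bands, and the band above is treated first, for all
    words on the lower bands at once; hence all colourings are families indexed
    by a finite type [J], and the length of a band depends only on the lower ones.

    For one tree and one variable, the colour of [(f(a), x_i)] is made constant
    over the letters [a] and the directions [i < h] by induction on [h].  If it
    is known for [h] (for finitely many trees simultaneously), stacking lines
    gives nodes [t_0, t_1, ...], each above the previous one in direction [h],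
    such that the colour at a leaf above [t_m] in a direction [i < h] depends
    only on the letters at [t_0, ..., t_(m-1)].  The one-step Carlson-Simpson
    theorem, a consequence of the Hales-Jewett theorem, yields [m < m'] and an
    assignment of the variables [m, ..., m' - 1] by letters and one new variable,
    among them [m], for which the colours at levels [m] and [m'] agree; a leaf
    above [t_m'] then serves as the leaf above [t_m] in direction [h].

    For [k + 1] levels, take [k] levels in a low band and one line above every
    node [s] on top of that band, in each of the [d] trees.  The colour at a
    top node is passed down as the colour at the low leaf below it, with its
    letter as a parameter. *)

Lemma pigeonhole_nat (F : finType) (g : nat -> F) :
  exists m m', [/\ m < m', m' <= #|F| & g m = g m'].
Proof.
have /injectivePn[x [y nxy gxy]] : ~~ injectiveb (fun i : 'I_#|F|.+1 => g i).
  by apply/negP => /injectiveP/leq_card; rewrite card_ord ltnn.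
have [ltxy|ltyx|/val_inj exy] := ltngtP x y.
- by exists x, y; split=> //; rewrite -ltnS.
- by exists y, x; split=> //; rewrite -ltnS.
- by rewrite exy eqxx in nxy.
Qed.

(** * Combinatorial lines and the Hales-Jewett theorem *)

Section Lines.

Variables (L : finType) (Col : finType).
Implicit Types (u v : seq L) (l : seq (option L)) (ls : seq (seq (option L))).

(** A line is a word over [option L] whose wildcard is [None]. *)
Definition fill (a : L) l : seq L := [seq odflt a x | x <- l].

Lemma size_fill a l : size (fill a l) = size l. Proof. exact: size_map. Qed.

Lemma fill_cat a l l' : fill a (l ++ l') = fill a l ++ fill a l'.
Proof. exact: map_cat. Qed.

Lemma fill_Some a u : fill a [seq Some x | x <- u] = u.
Proof. by rewrite /fill -map_comp map_id. Qed.

(* Lines are insensitive to letters of G when all later lines carry g,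
   whatever comes before. *)
Fixpoint focused (G : seq L) (g : L) (J : Type) (c : J -> seq L -> Col) ls :=
  if ls is l :: ls' then
    [/\ None \in l,
        forall j a, a \in G ->
          c j (fill a l ++ fill g (flatten ls')) =
          c j (fill g l ++ fill g (flatten ls')) &
        forall u, size u = size l -> focused G g (fun j v => c j (u ++ v)) ls']
  else True.

Definition line_on (G : seq L) (J : finType) (n : nat) : Prop :=
  forall c : J -> seq L -> Col, exists l,
    [/\ size l = n, None \in l &
        forall j a a', a \in G -> a' \in G -> c j (fill a l) = c j (fill a' l)].

(** The later lines are found first, for all beginnings of length [n1] at once; the first line is
    then chosen with the later ones filled by [g]. *)
Lemma focused_exists G g :
  (forall J, exists n, line_on G J n) -> g \in G ->
  forall M (J : finType), exists n, forall c : J -> seq L -> Col, exists ls,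
    [/\ size ls = M, size (flatten ls) = n & focused G g c ls].
Proof.
move=> HG gG; elim=> [|M IH] J; first by exists 0 => c; exists [::].
have [n1 H1] := HG J; have [n2 H2] := IH (J * n1.-tuple L)%type.
exists (n1 + n2) => c.
have [ls [sls fls Hls]] := H2 (fun p v => c p.1 (p.2 ++ v)).
have [l [sl Nl Hl]] := H1 (fun j v => c j (v ++ fill g (flatten ls))).
exists (l :: ls); split; rewrite /= ?sls // ?size_cat ?sl ?fls //; split=> //.
  by move=> j a aG; apply: Hl.
move=> u su; have /eqP su' : size u = n1 by rewrite su.
move: Hls; set u' := Tuple su'; have -> : u = u' by [].
move: u' => {su su' sl Nl Hl sls fls} {}u.
have: forall (c1 : J * n1.-tuple L -> seq L -> Col) (c2 : J -> seq L -> Col),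
   (forall j v, c1 (j, u) v = c2 j v) -> focused G g c1 ls -> focused G g c2 ls.
  elim: ls => //= l' ls IHls c1 c2 ec [Nl' Hl' Hr]; split=> //.
    by move=> j a aG; rewrite -!ec Hl'.
  move=> u' su'; apply: (IHls (fun j v => c1 j (u' ++ v))) (Hr u' su').
  by move=> j v; rewrite ec.
by apply.
Qed.

Lemma focused_cat G g J (c : J -> seq L -> Col) ls1 ls2 (u : seq L) :
  size u = size (flatten ls1) -> focused G g c (ls1 ++ ls2) ->
  focused G g (fun j v => c j (u ++ v)) ls2.
Proof.
elim: ls1 c u => [|l ls1 IH] c u /=; first by case: u.
rewrite size_cat => su [_ _ Hr].
have {}Hr := Hr (take (size l) u) _.
have := IH _ (drop (size l) u) _ (Hr _).
have -> : (fun (j : J) v => c j (take (size l) u ++ (drop (size l) u ++ v)))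
  = (fun (j : J) v => c j (u ++ v)).
  by do 2 apply: functional_extensionality => ?; rewrite catA cat_take_drop.
apply; first by rewrite size_drop su addKn.
by rewrite size_takel // su leq_addr.
Qed.

(** The lines of [ls1] pass from [a] to [g] one at a time, the last one first, so that all later
    lines carry [g] whenever a line is changed. *)
Lemma focused_fill G g J (c : J -> seq L -> Col) ls1 ls2 j a :
  a \in G -> focused G g c (ls1 ++ ls2) ->
  c j (fill a (flatten ls1) ++ fill g (flatten ls2)) =
  c j (fill g (flatten (ls1 ++ ls2))).
Proof.
move=> aG; elim: ls1 c => [|l ls1 IH] c //= [_ Hl Hr].
rewrite !fill_cat -(Hl j a aG) -catA.
by apply: (IH _ (Hr (fill a l) _)); rewrite size_fill.
Qed.

(** Induction on the letters, [b] being the new one. Given lines focused for the old letters,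
    consider the words with [b] in the first [m] lines and [g] in the rest. If two cuts [m < m']
    have equal colours, the lines between them form the required line: focusing handles the old
    letters, and filling by [b] turns the cut [m] into the cut [m']. *)
Lemma line_on_exists (G : seq L) (J : finType) :
  0 < size G -> exists n, line_on G J n.
Proof.
case: G => // g G _; elim: G J => [|b G IH] J.
  exists 1 => c; exists [:: None]; split=> // j a a'.
  by rewrite !inE => /eqP-> /eqP->.
have [n Hn] := focused_exists IH (mem_head g G) #|{ffun J -> Col}| J.
exists n => c; have [ls [sls fls Hls]] := Hn c.
have [m [m' [ltmm' lem' Em]]] := pigeonhole_nat
  (fun m => [ffun j => c j (fill b (flatten (take m ls))
                           ++ fill g (flatten (drop m ls)))]).
pose A := take m ls; pose B := take (m' - m) (drop m ls); pose C := drop m' ls.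
have eB : drop m ls = B ++ C.
  by rewrite -(cat_take_drop (m' - m) (drop m ls)) drop_drop subnK // ltnW.
have eA : take m' ls = A ++ B.
  by rewrite -{1}(subnKC (ltnW ltmm')) takeD.
have els : ls = A ++ (B ++ C) by rewrite -eB cat_take_drop.
pose l := [seq Some x | x <- fill b (flatten A)] ++ flatten B
          ++ [seq Some x | x <- fill g (flatten C)].
have fl a : fill a l = fill b (flatten A) ++ fill a (flatten B)
                       ++ fill g (flatten C).
  by rewrite !fill_cat !fill_Some.
have HBC : focused (g :: G) g (fun j v => c j (fill b (flatten A) ++ v)) (B ++ C).
  by rewrite els in Hls; apply: focused_cat Hls; rewrite size_fill.
have col j a : a \in g :: b :: G ->
    c j (fill a l) = c j (fill b (flatten A) ++ fill g (flatten (B ++ C))).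
  rewrite fl => aG; have [aGg|naG] := boolP (a \in g :: G).
    by rewrite (@focused_fill _ _ _
      (fun j v => c j (fill b (flatten A) ++ v)) _ _ j a aGg HBC).
  have -> : a = b by move: aG naG; rewrite !inE => /or3P[->|/eqP->|->] //; rewrite orbT.
  move: Em => /= /ffunP/(_ j); rewrite !ffunE eA eB -/A -/C (flatten_cat A B) fill_cat => ->.
  by rewrite catA.
exists l; split; last by move=> j a a' aG a'G; rewrite !col.
  by rewrite /l !size_cat !size_map addnA -!size_cat -!flatten_cat -catA -els.
have B0 : 0 < size B.
  by rewrite size_take_min size_drop leq_min !subn_gt0 ltmm' sls (leq_trans ltmm').
case: B B0 HBC @l {fl eB eA els col} => // l0 B _ /= [Nl0 _ _].
by rewrite !mem_cat Nl0 /= !orbT.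
Qed.

Theorem hales_jewett (J : finType) : 0 < #|L| -> exists n,
  forall c : J -> seq L -> Col, exists l,
    [/\ size l = n, None \in l &
        forall j a a', c j (fill a l) = c j (fill a' l)].
Proof.
move=> L0; have [|n Hn] := @line_on_exists (enum L) J; first by rewrite -cardE.
exists n => c; have [l [sl Nl Hl]] := Hn c; exists l; split=> // j a a'.
by apply: Hl; rewrite mem_enum.
Qed.

(** * The one-step Carlson-Simpson theorem *)

Definition fills (us : seq L) ls : seq L :=
  flatten [seq fill p.1 p.2 | p <- zip us ls].

Lemma fills_cat u1 u2 ls1 ls2 : size u1 = size ls1 ->
  fills (u1 ++ u2) (ls1 ++ ls2) = fills u1 ls1 ++ fills u2 ls2.
Proof. by move=> s12; rewrite /fills zip_cat // map_cat flatten_cat. Qed.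

Lemma fills_nil ls : fills [::] ls = [::].
Proof. by case: ls. Qed.

Lemma fills_nseq a ls : fills (nseq (size ls) a) ls = fill a (flatten ls).
Proof. by elim: ls => //= l ls IH; rewrite fill_cat -IH. Qed.

(** The variable part of a Carlson-Simpson word begins with the variable itself, so the words to be
    compared stop just before the first wildcard of a line. *)
Definition before_wild (g : L) l : seq L := fill g (take (index None l) l).

Lemma before_wildE g l :
  [seq Some x | x <- before_wild g l] = take (index None l) l.
Proof. by rewrite /before_wild; elim: l => [|[x|] l IH] //=; rewrite -[in RHS]IH. Qed.

(** Since [zip] truncates, [fills u ls] uses only the first [size u] lines. The later lines are
    found for all beginnings at once; the first line then comes from Hales-Jewett, for the [M] later
    stopping points at once. *)
Lemma stable_lines_exist (g : L) M (J : finType) : exists n,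
  forall c : J -> seq L -> Col, exists ls,
  [/\ size ls = M, size (flatten ls) = n, all (fun l => None \in l) ls &
      forall m u j, m < M -> size u = m ->
        c j (fills u ls ++ before_wild g (nth [::] ls m)) =
        c j (fills (nseq m g) ls ++ before_wild g (nth [::] ls m))].
Proof.
have L0 : 0 < #|L| by apply/card_gt0P; exists g.
elim: M J => [|M IH] J; first by exists 0 => c; exists [::].
have [n1 H1] := hales_jewett (J * 'I_M)%type L0.
have [n2 H2] := IH (J * n1.-tuple L)%type; exists (n1 + n2) => c.
have [ls [sls fls wls Hls]] := H2 (fun p v => c p.1 (p.2 ++ v)).
have [l [sl wl Hl]] := H1 (fun p u => c p.1
  (u ++ fills (nseq p.2 g) ls ++ before_wild g (nth [::] ls p.2))).
exists (l :: ls); split; rewrite /= ?sls ?size_cat ?sl ?fls ?wl // => m u j.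
case: m u => [|m] [|a u] //= ltmM [su]; rewrite ltnS in ltmM.
have /eqP sa : size (fill a l) = n1 by rewrite size_fill.
rewrite /fills /= -!/(fills _ _) -!catA.
rewrite (Hls m u (j, Tuple sa) ltmM su).
exact: (Hl (j, Ordinal ltmM) a g).
Qed.

(** By pigeonhole, two stopping points [pt m] and [pt m'] have equal colours. Putting the new
    variable into all wildcards between them does not affect the colour at [pt m'], by stability,
    and the variable comes directly after [pt m]. *)
Theorem carlson_simpson (J : finType) : 0 < #|L| -> exists n,
  forall c : J -> seq L -> Col, exists u l, size u + (size l).+1 <= n /\
    forall j a, c j (u ++ fill a (None :: l)) = c j u.
Proof.
case/card_gt0P=> g _; pose M := #|{ffun J -> Col}|.
(* One line more than the largest stopping point [M], as line [m'] has to exist. *)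
have [n Hn] := stable_lines_exist g M.+1 J; exists n => c.
have [ls [sls fls wls Hls]] := Hn c.
pose pt m := fills (nseq m g) ls ++ before_wild g (nth [::] ls m).
have [m [m' [ltmm' lem' Em]]] := pigeonhole_nat (fun m => [ffun j => c j (pt m)]).
pose A := take m ls; pose B := take (m' - m) (drop m ls); pose C := drop m' ls.
have sA : size A = m.
  by rewrite size_takel // sls (leq_trans (ltnW ltmm')) // leqW.
have sB : size B = m' - m by rewrite size_takel // size_drop sls leq_sub2r // leqW.
have eB : drop m ls = B ++ C.
  by rewrite -(cat_take_drop (m' - m) (drop m ls)) drop_drop subnK // ltnW.
have els : ls = A ++ (B ++ C) by rewrite -eB cat_take_drop.
have C0 : 0 < size C by rewrite size_drop sls subn_gt0 ltnS.
case eqB : B sB => [|b B'] sB; first by move: ltmm'; rewrite -subn_gt0 -sB.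
case eqC : C C0 => [|d C'] // _.
have nthm : nth [::] ls m = b by rewrite els nth_cat sA ltnn subnn eqB.
have nthm' : nth [::] ls m' = d.
  rewrite els nth_cat sA ltnNge (ltnW ltmm') /= nth_cat.
  by rewrite eqB sB ltnn subnn eqC.
have wb : None \in b by move/allP: wls; apply; rewrite els eqB mem_cat mem_head orbT.
pose l := drop (index None b).+1 b ++ flatten B'
          ++ [seq Some x | x <- before_wild g d].
have el : None :: l = drop (index None b) b ++ flatten B'
          ++ [seq Some x | x <- before_wild g d].
  by rewrite (drop_nth None) ?index_mem // nth_index.
have pt_m : pt m = fill g (flatten A) ++ before_wild g b.
  rewrite /pt nthm els -{1}(cats0 (nseq m g)) fills_cat ?size_nseq //.
  by rewrite -{1}sA fills_nseq fills_nil cats0.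
exists (pt m), l; split.
  have -> : n = size (flatten A) + (size b + size (flatten B') + (size d + size (flatten C'))).
    by rewrite -fls els eqB eqC -!size_cat !flatten_cat.
  rewrite -[(size l).+1]/(size (None :: l)) el pt_m !size_cat size_map !size_fill.
  rewrite -!addnA leq_add2l addnA -size_cat cat_take_drop !leq_add2l.
  by rewrite (leq_trans _ (leq_addr _ _)) // size_takel // index_size.
move=> j a; have <- : c j (pt m') = c j (pt m).
  by move: Em => /= /ffunP/(_ j); rewrite !ffunE.
rewrite -/(pt m') /pt -(Hls m' (nseq m g ++ nseq (m' - m) a)) ?ltnS //; last first.
  by rewrite size_cat !size_nseq subnKC // ltnW.
rewrite -/(pt m) pt_m el nthm' [in RHS]els fills_cat ?size_nseq //.
rewrite -{1}sA fills_nseq -[nseq (m' - m) a]cats0 fills_cat ?size_nseq ?eqB //.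
rewrite -{1}sB fills_nseq fills_nil cats0 [flatten (b :: B')]/=.
rewrite -/(flatten B') !fill_cat fill_Some -!catA; congr (c j (_ ++ _)).
rewrite !catA; congr ((_ ++ _) ++ _).
rewrite -[b in RHS](cat_take_drop (index None b)) fill_cat.
by rewrite -(before_wildE g) fill_Some.
Qed.

End Lines.

Lemma prefix_cat2l (T : eqType) (p s t : seq T) :
  prefix (p ++ s) (p ++ t) = prefix s t.
Proof. by rewrite prefix_catr // eqxx. Qed.

(** * Words on trees and lines with one variable *)

Section TreeWords.

Variables (b' : nat) (L : finType) (a0 : L) (Col : finType).
Notation b := b'.+1.
Notation T := (seq 'I_b).
Notation tword := (T -> L).
Implicit Types (z s t p : T) (w : tword).

Definition supported n w := forall z, n <= size z -> w z = a0.

(** Supported words are coded in a finite type, so that the words on a low band can index a family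
    of colourings. *)
Definition table n w : {ffun n.-bseq 'I_b -> L} := [ffun z : n.-bseq _ => w z].

Definition of_table n (r : {ffun n.-bseq 'I_b -> L}) : tword :=
  fun z => if size z < n then r (insubd [bseq] z) else a0.

Lemma tableK n w : supported n w -> of_table (table n w) = w.
Proof.
move=> wn; apply: functional_extensionality => z; rewrite /of_table.
case: ltnP => [ltzn|/wn //]; rewrite ffunE /= insubdK //.
by rewrite -topredE /= ltnW.
Qed.

Definition shift n w : tword :=
  fun z => if prefix (nseq n ord0) z then w (drop n z) else a0.

Definition glue n w (g : T -> tword) : tword :=
  fun z => if size z < n then w z else g (take n z) (drop n z).

Definition to_tuple n z : n.-tuple 'I_b := insubd (nseq_tuple n ord0) z.

Lemma to_tupleK n z : size z = n -> to_tuple n z = z :> T.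
Proof. by move=> /eqP zn; rewrite /to_tuple val_insubd zn. Qed.

(* A variable word with the single variable [None], together with a node and
   a leaf in each direction above it. *)
Record line := Line {
  lnode : T;
  lleaf : 'I_b -> T;
  lword : T -> option L }.

Definition valid_line n (l : line) : Prop :=
  [/\ size (lnode l) < n,
      forall a, size (lleaf l a) = n /\ prefix (rcons (lnode l) a) (lleaf l a),
      lword l (lnode l) = None,
      forall z, lword l z = None -> prefix (lnode l) z &
      forall z, n <= size z -> lword l z = Some a0].

Definition inst (l : line) (a : L) : tword := fun z => odflt a (lword l z).

Definition pos (l : line) (y : option 'I_b) : T :=
  if y is Some a then lleaf l a else lnode l.

Lemma supported_inst n l a : valid_line n l -> supported n (inst l a).
Proof. by case=> _ _ _ _ H z /H; rewrite /inst => ->. Qed.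

Lemma size_pos n l y : valid_line n l -> size (pos l y) <= n.
Proof. by case=> ltn H _ _ _; case: y => [a|] /=; rewrite ?(H a).1 // ltnW. Qed.

(** The changes that must not affect a colour: between leaves in directions below [h] the letter is
    free as well, while at the node of the line the letter stays visible. *)
Definition agree h (a a' : L) (y y' : option 'I_b) : bool :=
  match y, y' with
  | Some i, Some i' => (i < h) && (i' < h)
  | None, None => a == a'
  | _, _ => false
  end.

Definition single_stable h : Prop :=
  forall J : finType, exists n, forall c : J -> tword -> T -> Col,
  exists l, valid_line n l /\
    forall j a a' (i i' : 'I_b), i < h -> i' < h ->
      c j (inst l a) (lleaf l i) = c j (inst l a') (lleaf l i').

(** Every [e] has its own tree. The order of [es] governs the lengths of the nodes, which later
    yields the length conditions on skew subtrees. *)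
Definition product_stable h : Prop :=
  forall (E : finType) (es : seq E) (J : finType), uniq es ->
  exists n, forall c : J -> (E -> tword) -> (E -> T) -> Col,
  exists D : E -> line,
  [/\ forall e, e \in es -> valid_line n (D e),
      pairwise (fun e e' => size (lnode (D e)) <= size (lnode (D e'))) es &
      forall j (a a' : E -> L) (y y' : E -> option 'I_b),
        (forall e, agree h (a e) (a' e) (y e) (y' e)) ->
        c j (fun e => inst (D e) (a e)) (fun e => pos (D e) (y e)) =
        c j (fun e => inst (D e) (a' e)) (fun e => pos (D e) (y' e))].

(** * Moving lines between bands *)

Definition shift_line n (l : line) : line :=
  Line (nseq n ord0 ++ lnode l) (fun a => nseq n ord0 ++ lleaf l a)
       (fun z => if prefix (nseq n ord0) z then lword l (drop n z) else Some a0).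

(** Leaves have length exactly [n] and must reach the new top; nodes are shorter and stay where they
    are. *)
Definition pad n n' z := if size z == n then z ++ nseq n' ord0 else z.

Definition pad_line n n' (l : line) : line :=
  Line (lnode l) (fun a => pad n n' (lleaf l a)) (lword l).

Lemma inst_shift n l a : inst (shift_line n l) a = shift n (inst l a).
Proof.
by apply: functional_extensionality => z; rewrite /inst /shift /=; case: ifP.
Qed.

Lemma pos_shift n l y : pos (shift_line n l) y = nseq n ord0 ++ pos l y.
Proof. by case: y. Qed.

Lemma pos_pad n n' l y : valid_line n l ->
  pos (pad_line n n' l) y = pad n n' (pos l y).
Proof. by case: y => //= -[ltn _ _ _ _]; rewrite /pad ltn_eqF. Qed.

Lemma valid_shift n n' l : valid_line n' l -> valid_line (n + n') (shift_line n l).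
Proof.
case=> ltn leafP node1 wordP supp; split=> /=.
- by rewrite size_cat size_nseq ltn_add2l.
- move=> a; have [sl pl] := leafP a; rewrite size_cat size_nseq sl; split=> //.
  by rewrite rcons_cat prefix_cat2l.
- by rewrite prefix_prefix drop_size_cat ?size_nseq.
- move=> z; case: ifP => // /prefixP[u ->]; rewrite drop_size_cat ?size_nseq //.
  by move/wordP; rewrite prefix_cat2l.
- move=> z lez; case: ifP => // /prefixP[u eu]; rewrite supp // size_drop.
  by rewrite leq_subRL // (leq_trans _ lez) // leq_addr.
Qed.

Lemma valid_pad n n' l : valid_line n l -> valid_line (n + n') (pad_line n n' l).
Proof.
case=> ltn leafP node1 wordP supp; split=> //=.
- exact: leq_trans (leq_addr _ _).
- move=> a; have [sl pl] := leafP a; rewrite /pad sl eqxx size_cat size_nseq sl.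
  by split=> //; rewrite (prefix_trans pl) // prefix_prefix.
- by move=> z lez; rewrite supp // (leq_trans (leq_addr _ _) lez).
Qed.

(** The first tree of the list works in the low band, with padded leaves; the others work above the
    node of [n1] zeros, so their nodes are longer. The upper lines are found for all words and
    positions in the low band, the low line then for all letters and positions of the others. *)
Lemma product_stable_single h : single_stable h -> product_stable h.
Proof.
move=> Sh E; elim=> [|e0 es IH] J.
  move=> _; exists 0 => c; exists (fun=> Line [::] (fun=> [::]) (fun=> Some a0)).
  split=> // j a a' y y' Hy; congr (c j _ _).
  by apply: functional_extensionality => e /=; case: (y e); case: (y' e).
case/andP=> e0es Ues.
have [n1 H1] := Sh (J * {ffun E -> L} * {ffun E -> option 'I_b})%type.
have [n2 H2] := IH (J * {ffun n1.-bseq 'I_b -> L} * n1.-bseq 'I_b)%type Ues.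
exists (n1 + n2) => c.
pose c2 (q : J * {ffun n1.-bseq 'I_b -> L} * n1.-bseq 'I_b) (V : E -> tword) Y :=
  c q.1.1 (fun e => if e == e0 then of_table q.1.2 else shift n1 (V e))
          (fun e => if e == e0 then pad n1 n2 q.2 else nseq n1 ord0 ++ Y e).
have [D [vD sD gD]] := H2 c2.
pose c1 (q : J * {ffun E -> L} * {ffun E -> option 'I_b}) w x :=
  c q.1.1 (fun e => if e == e0 then w else shift n1 (inst (D e) (q.1.2 e)))
          (fun e => if e == e0 then pad n1 n2 x else nseq n1 ord0 ++ pos (D e) (q.2 e)).
have [l [vl gl]] := H1 c1.
exists (fun e => if e == e0 then pad_line n1 n2 l else shift_line n1 (D e)).
split.
- move=> e; rewrite inE; case: eqP => [_ _|_ /= /vD]; first exact: valid_pad.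
  exact: valid_shift.
- rewrite /= eqxx; apply/andP; split.
    apply/allP => e ees; case: eqP => // _ /=; rewrite size_cat size_nseq.
    by case: vl => ltn _ _ _ _; rewrite (leq_trans (ltnW ltn)) // leq_addr.
  have all_es : all [in es] es by apply/allP.
  apply: (sub_in_pairwise _ all_es sD) => e e' ees e'es.
  have -> : e == e0 = false by apply: contraNF e0es => /eqP <-.
  have -> : e' == e0 = false by apply: contraNF e0es => /eqP <-.
  by rewrite /= !size_cat leq_add2l.
move=> j a a' y y' agr.
have inE2 (aa : E -> L) : (fun e => inst (if e == e0 then pad_line n1 n2 l
     else shift_line n1 (D e)) (aa e)) =
   (fun e => if e == e0 then inst l (aa e0) else shift n1 (inst (D e) (aa e))).
  apply: functional_extensionality => e; case: eqP => [->|_] //.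
  exact: inst_shift.
have posE2 (yy : E -> option 'I_b) : (fun e => pos (if e == e0 then pad_line n1 n2 l
     else shift_line n1 (D e)) (yy e)) =
   (fun e => if e == e0 then pad n1 n2 (pos l (yy e0)) else nseq n1 ord0 ++ pos (D e) (yy e)).
  apply: functional_extensionality => e; case: eqP => [->|_] //.
    exact: pos_pad.
  exact: pos_shift.
rewrite !inE2 !posE2.
have Ey : forall y, val (insubd [bseq] (pos l y) : n1.-bseq 'I_b) = pos l y.
  by move=> y0; rewrite val_insubd size_pos.
have Et : forall a, of_table (table n1 (inst l a)) = inst l a.
  by move=> a1; apply: tableK; apply: supported_inst.
(* First the other trees change, the word and position in the tree of [e0] being an index; then [e0]
   changes, unless its position is the node, where the letters are equal. *)
have := gD (j, table n1 (inst l (a e0)), insubd [bseq] (pos l (y e0))) a a' y y' agr.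
rewrite /c2 /= Ey Et => ->.
have := agr e0; rewrite /agree.
case Ey0: (y e0) => [i|]; case Ey0': (y' e0) => [i'|] //; last by move/eqP->.
have c1E w x : c1 (j, finfun a', finfun y') w x =
  c j (fun e => if e == e0 then w else shift n1 (inst (D e) (a' e)))
      (fun e => if e == e0 then pad n1 n2 x else nseq n1 ord0 ++ pos (D e) (y' e)).
  by congr (c j _ _); apply: functional_extensionality => e; rewrite /= ffunE.
case/andP=> ih ih'; have := gl (j, finfun a', finfun y') (a e0) (a' e0) i i' ih ih'.
by rewrite !c1E.
Qed.

(** * Combs: lines stacked along a spine *)

Definition comb_inst (f : T -> L + nat) (u : nat -> L) : tword :=
  fun z => match f z with inl a => a | inr q => u q end.

(* [inr m] marks the variable of the node [ct m]; [ce] is a free leaf at the end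
   of the spine, at which the next node is attached. *)
Definition valid_comb (h : 'I_b) N n (ct : nat -> T) (cx : nat -> 'I_b -> T)
    (ce : T) (f : T -> L + nat) : Prop :=
  [/\ forall m, m < N -> size (ct m) < n /\
        (forall a, size (cx m a) = n /\ prefix (rcons (ct m) a) (cx m a)),
      forall m m', m < m' -> m' < N -> prefix (rcons (ct m) h) (ct m'),
      size ce = n /\ forall m, m < N -> prefix (rcons (ct m) h) ce,
      forall m, m < N -> f (ct m) = inr m &
      (forall z m, f z = inr m -> m < N /\ prefix (ct m) z) /\
      (forall z, n <= size z -> f z = inl a0)].

Lemma supported_comb h N n ct cx ce f u :
  valid_comb h N n ct cx ce f -> supported n (comb_inst f u).
Proof. by case=> _ _ _ _ [_ H] z /H; rewrite /comb_inst => ->. Qed.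

Lemma prefix_rconsW z a s : prefix (rcons z a) s -> prefix z s.
Proof. by apply: prefix_trans; apply: prefix_rcons. Qed.

(** A new band puts a line above every node of level [n1]; the one above [ce] gets the new variable,
    the others the letter [a0]. By stability the colours at leaves do not see the new letter, and
    old leaves may be continued in direction 0, which is admissible as [0 < h]. *)
Lemma comb_exists (h : 'I_b) : 0 < h -> product_stable h ->
  forall N (J : finType), exists n, forall c : J -> tword -> T -> Col,
  exists ct cx ce f, valid_comb h N n ct cx ce f /\
    forall j m (i i' : 'I_b) u u', m < N -> i < h -> i' < h ->
      (forall q, q < m -> u q = u' q) ->
      c j (comb_inst f u) (cx m i) = c j (comb_inst f u') (cx m i').
Proof.
move=> h0 Vh; elim=> [|N IH] J.
  exists 0 => c; exists (fun=> [::]), (fun _ _ => [::]), [::], (fun=> inl a0).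
  by split=> //; split.
have [n1 H1] := IH J.
pose E : finType := n1.-tuple 'I_b.
have [n2 H2] := Vh E (enum E) (J * {ffun n1.-bseq 'I_b -> L} * E)%type (enum_uniq E).
exists (n1 + n2) => c.
have [D [vD _ gD]] := H2 (fun q V Y => c q.1.1
  (glue n1 (of_table q.1.2) (fun s => V (to_tuple n1 s))) (tval q.2 ++ Y q.2)).
have {}vD e : valid_line n2 (D e) by apply: vD; rewrite mem_enum.
have [ct [cx [ce [f [vC gC]]]]] := H1 (fun j w p => c j
  (glue n1 w (fun s => inst (D (to_tuple n1 s)) a0))
  (p ++ lleaf (D (to_tuple n1 p)) ord0)).
have [Hct Hlt [sce Hce] Hvar [Hpre Hsupp]] := vC.
pose e := to_tuple n1 ce.
have ee : tval e = ce by apply: to_tupleK.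
pose g z := if size z < n1 then f z else
  match lword (D (to_tuple n1 (take n1 z))) (drop n1 z) with
  | Some a => inl a
  | None => if take n1 z == ce then inr N else inl a0
  end.
exists (fun m => if m < N then ct m else ce ++ lnode (D e)),
  (fun m a => if m < N then cx m a ++ lleaf (D (to_tuple n1 (cx m a))) ord0
              else ce ++ lleaf (D e) a),
  (ce ++ lleaf (D e) h), g.
have [ltDe leafDe nodeDe preDe suppDe] := vD e.
have gl u : comb_inst g u = glue n1 (comb_inst f u)
    (fun s => inst (D (to_tuple n1 s)) (if to_tuple n1 s == e then u N else a0)).
  apply: functional_extensionality => z; rewrite /comb_inst /glue /g /inst.
  case: ltnP => // lez; case: lword => //=.
  have <- : (take n1 z == ce) = (to_tuple n1 (take n1 z) == e).
    by rewrite -val_eqE /= ee to_tupleK // size_takel.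
  by case: eqP.
split.
  split.
  - move=> m; rewrite ltnS leq_eqVlt => /orP[/eqP->|ltmN]; rewrite ?ltnn.
      split; first by rewrite size_cat sce ltn_add2l.
      move=> a; have [sl pl] := leafDe a.
      by rewrite size_cat sce sl rcons_cat prefix_cat2l.
    rewrite ltmN; have [lt1 H] := Hct m ltmN; split; first exact: leq_trans (leq_addr _ _).
    move=> a; have [sx px] := H a; have [_ leafD _ _ _] := vD (to_tuple n1 (cx m a)).
    by rewrite size_cat sx (leafD ord0).1; split=> //; apply: prefix_catl.
  - move=> m m' ltmm'; rewrite ltnS leq_eqVlt => /orP[/eqP em'|ltm'N].
      by rewrite em' ltnn -em' ltmm'; apply/prefix_catl/Hce; rewrite -em'.
    by rewrite ltm'N (ltn_trans ltmm') //; apply: Hlt.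
  - split; first by rewrite size_cat sce (leafDe h).1.
    move=> m; rewrite ltnS leq_eqVlt => /orP[/eqP->|ltmN].
      by rewrite ltnn rcons_cat prefix_cat2l (leafDe h).2.
    by rewrite ltmN; apply/prefix_catl/Hce.
  - move=> m; rewrite ltnS leq_eqVlt => /orP[/eqP->|ltmN].
      rewrite ltnn /g size_cat sce ltnNge leq_addr /= take_size_cat // drop_size_cat //.
      by rewrite nodeDe eqxx.
    by rewrite ltmN /g (Hct m ltmN).1 Hvar.
  - split.
      move=> z m; rewrite /g; case: ltnP => lez.
        by case/Hpre=> ltmN px; rewrite ltmN ltnW // ltnS ltmN.
      case Ew: lword => [//|]; case: eqP => // tz [<-]; rewrite ltnSn ltnn; split=> //.
      by rewrite -(cat_take_drop n1 z) tz prefix_cat2l; apply: preDe; rewrite /e -tz.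
    move=> z lez; rewrite /g ltnNge (leq_trans (leq_addr _ _) lez) /=.
    have [_ _ _ _ ->] // := vD (to_tuple n1 (take n1 z)).
    by rewrite size_drop leq_subRL // (leq_trans _ lez) // leq_addr.
have top u a (q : E) (i : 'I_b) : i < h ->
    c a (glue n1 (comb_inst f u) (fun s => inst (D (to_tuple n1 s))
       (if to_tuple n1 s == e then u N else a0))) (tval q ++ lleaf (D q) i) =
    c a (glue n1 (comb_inst f u) (fun s => inst (D (to_tuple n1 s)) a0))
       (tval q ++ lleaf (D q) ord0).
  move=> ih.
  have := gD (a, table n1 (comb_inst f u), q)
    (fun e' => if e' == e then u N else a0) (fun=> a0)
    (fun=> Some i) (fun=> Some ord0).
  rewrite /= (tableK (supported_comb u vC)); apply=> e'.
  by rewrite ih h0.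
move=> j m i i' u u'; rewrite ltnS leq_eqVlt => /orP[/eqP->|ltmN] ih i'h uu'.
  rewrite ltnn !gl -!ee !top //.
  congr (c j (glue n1 _ _) _); apply: functional_extensionality => z.
  rewrite /comb_inst; case Ez: (f z) => [//|q].
  by apply: uu'; case: (Hpre _ _ Ez).
rewrite ltmN !gl.
have sx i0 : tval (to_tuple n1 (cx m i0)) = cx m i0.
  by apply: to_tupleK; case: (Hct m ltmN) => _ /(_ i0)[].
have := top u j (to_tuple n1 (cx m i)) ord0 h0.
have := top u' j (to_tuple n1 (cx m i')) ord0 h0.
by rewrite !sx => -> ->; apply: gC.
Qed.

(** On the branch of zeros, a word on the tree is an ordinary word of length [n], so Hales-Jewett
    applies; the node sits at the first wildcard. *)
Lemma single_stable1 : single_stable 1.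
Proof.
move=> J; have L0 : 0 < #|L| by apply/card_gt0P; exists a0.
have [n Hn] := hales_jewett Col J L0; exists n => c.
pose chain u : tword :=
  fun z => if z == nseq (size z) ord0 then nth a0 u (size z) else a0.
have [l [sl wl Hl]] := Hn (fun j u => c j (chain u) (nseq n ord0)).
pose m := index None l; have ltmn : m < n by rewrite -sl index_mem.
exists (Line (nseq m ord0) (fun a => nseq m ord0 ++ a :: nseq (n - m.+1) ord0)
  (fun z => if z == nseq (size z) ord0 then nth (Some a0) l (size z) else Some a0)).
have en : nseq m ord0 ++ ord0 :: nseq (n - m.+1) ord0 = nseq n ord0 :> T.
  by rewrite -[_ :: _]/(nseq (n - m.+1).+1 ord0) -nseqD subnSK // subnKC // ltnW.
split.
  split=> /=.
  - by rewrite size_nseq.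
  - move=> a; rewrite size_cat /= !size_nseq subnSK // subnKC ?(ltnW ltmn) //.
    by rewrite -cats1 prefix_cat2l /= eqxx prefix0s.
  - by rewrite size_nseq eqxx -/m (set_nth_default None) ?sl // nth_index.
  - move=> z; case: eqP => // ez /(congr1 (fun x => x == None)) nz.
    rewrite [in X in prefix _ X]ez; set k := size z in nz *.
    have lemk : m <= k.
      rewrite leqNgt; apply/negP => ltkm; move: nz; rewrite eqxx.
      rewrite (set_nth_default None) ?sl ?(ltn_trans ltkm) //.
      by have /= -> := before_find _ ltkm.
    by rewrite -(subnKC lemk) nseqD prefix_prefix.
  - by move=> z lez; case: eqP => // _; rewrite nth_default // sl.
have inst_chain a : inst (Line (nseq m ord0) (fun a => nseq m ord0 ++ a :: nseq (n - m.+1) ord0)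
  (fun z => if z == nseq (size z) ord0 then nth (Some a0) l (size z) else Some a0)) a
  = chain (fill a l).
  apply: functional_extensionality => z; rewrite /inst /chain /=; case: eqP => // _.
  have [ltz|lez] := ltnP (size z) (size l); first by rewrite (nth_map (Some a0)).
  by rewrite !nth_default ?size_map.
move=> j a a' i i'; rewrite !ltnS !leqn0 => /eqP i0 /eqP i'0.
have -> : i = ord0 by apply: val_inj.
have -> : i' = ord0 by apply: val_inj.
by rewrite !inst_chain /= en.
Qed.

Lemma single_stableS h : 0 < h -> h < b -> single_stable h -> single_stable h.+1.
Proof.
move=> h0 hb Sh J; have L0 : 0 < #|L| by apply/card_gt0P; exists a0.
pose hh : 'I_b := Ordinal hb.
have [N HN] := carlson_simpson Col J L0.
(* The index [m'] of the upper node can be [N] itself, so the comb has [N.+1] nodes. *)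
have [n Hn] := @comb_exists hh h0 (product_stable_single Sh) N.+1 J.
exists n => c; have [ct [cx [ce [f [vC gC]]]]] := Hn c.
have [Hct Hlt _ Hvar [Hpre Hsupp]] := vC.
(* A word [u] gives the letters of the first [size u] variables, on which alone the colour at
   [cx (size u)] depends; later variables are [a0] by default. *)
have [u [l [sul Hul]]] := HN (fun j u => c j (comb_inst f (nth a0 u)) (cx (size u) ord0)).
pose m := size u; pose m' := m + (size l).+1.
have ltmm' : m < m' by rewrite /m' addnS ltnS leq_addr.
have ltm'N : m' < N.+1 by rewrite ltnS.
have ltmN : m < N.+1 := ltn_trans ltmm' ltm'N.
(* The leaf in direction [h] is borrowed from [ct m'], which lies above [ct m] in that direction. *)
pose ll := Line (ct m) (fun a => if a == hh then cx m' ord0 else cx m a)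
  (fun z => match f z with
            | inl a => Some a
            | inr q => nth (Some a0) ([seq Some x | x <- u] ++ None :: l) q
            end).
have instE a : inst ll a = comb_inst f (nth a0 (u ++ fill a (None :: l))).
  apply: functional_extensionality => z; rewrite /inst /comb_inst /=.
  case: (f z) => // q.
  have -> : u ++ fill a (None :: l) = fill a ([seq Some x | x <- u] ++ None :: l).
    by rewrite fill_cat fill_Some.
  have [ltq|leq] := ltnP q (size ([seq Some x | x <- u] ++ None :: l)).
    by rewrite (nth_map (Some a0)).
  by rewrite !nth_default ?size_map.
exists ll; split.
  split=> /=.
  - by case: (Hct m ltmN).
  - move=> a; case: eqP => [->|_]; last by case: (Hct m ltmN).
    have [_ /(_ ord0)[sx px]] := Hct m' ltm'N; split=> //.
    exact: prefix_trans (Hlt _ _ ltmm' ltm'N) (prefix_rconsW px).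
  - by rewrite Hvar // nth_cat size_map ltnn subnn.
  - move=> z; case Ez: (f z) => [//|q]; have [ltqN pq] := Hpre _ _ Ez.
    rewrite nth_cat size_map -/m; case: ltnP => [ltqm|].
      by rewrite (nth_map a0).
    rewrite leq_eqVlt => /orP[/eqP-> //|ltmq] _.
    exact: prefix_trans (prefix_rconsW (Hlt _ _ ltmq ltqN)) pq.
  - by move=> z /Hsupp->.
have colE j a (i : 'I_b) : i < h.+1 ->
    c j (inst ll a) (lleaf ll i) = c j (comb_inst f (nth a0 u)) (cx m ord0).
  rewrite ltnS leq_eqVlt instE /= => /orP[/eqP ih|ih].
    have -> : i == hh by rewrite -val_eqE /= ih.
    by have := Hul j a; rewrite size_cat /= size_map.
  have -> : i == hh = false by rewrite -val_eqE /= ltn_eqF.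
  apply: gC => // q ltq.
  by rewrite nth_cat ltq.
by move=> j a a' i i' ih i'h; rewrite !colE.
Qed.

Lemma product_stable_full : product_stable b.
Proof.
apply: product_stable_single.
have: forall h, h <= b' -> single_stable h.+1.
  elim=> [|h IH] hb; first exact: single_stable1.
  by apply: single_stableS => //; apply: IH; apply: ltnW.
exact.
Qed.
End TreeWords.

(** * Embeddings of the full tree *)

Section Embeddings.

Variable b : nat.
Notation T := (seq 'I_b).
Implicit Types (s r : T) (a : 'I_b) (phi : T -> T).

Lemma lex_le_total s s' : lex_le s s' || lex_le s' s.
Proof. by rewrite !lex_leE; apply: Order.TotalTheory.le_total. Qed.

Lemma lex_le_trans : transitive (@lex_le b).
Proof. by move=> s r s'; rewrite !lex_leE; apply: Order.POrderTheory.le_trans. Qed.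

Lemma lex_le_anti : antisymmetric (@lex_le b).
Proof. by move=> s s'; rewrite !lex_leE; apply: Order.POrderTheory.le_anti. Qed.

Lemma lex_le_diverge r a a' s s' : a != a' ->
  lex_le (r ++ a :: s) (r ++ a' :: s') = (a < a').
Proof.
move=> naa'; elim: r => [|x r IH] /=; rewrite !lex_leE Order.SeqLexiOrder.lexi_cons.
  rewrite !Order.OrdinalOrder.leEord leq_eqVlt val_eqE (negPf naa') /=.
  by case: ltngtP => //= /val_inj e; rewrite e eqxx in naa'.
by rewrite Order.POrderTheory.lexx /= -lex_leE IH.
Qed.

Lemma lcp_decomp s s' : [\/ prefix s s', prefix s' s |
  exists r a a' u u', [/\ s = r ++ a :: u, s' = r ++ a' :: u' & a != a']].
Proof.
elim: s s' => [|x s IH] [|y s']; try by [constructor 1|constructor 2].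
have [<-|nxy] := eqVneq x y; last first.
  by constructor 3; exists [::], x, y, s, s'.
case: (IH s') => [h|h|[r [a [a' [u [u' [-> -> n]]]]]]].
- by constructor 1; rewrite /= eqxx.
- by constructor 2; rewrite /= eqxx.
- by constructor 3; exists (x :: r), a, a', u, u'.
Qed.

Lemma prefix_anti s s' : prefix s s' -> prefix s' s -> s = s'.
Proof.
move=> /prefixP[u ->] /size_prefix; rewrite size_cat -{2}(addn0 (size s)).
by rewrite leq_add2l leqn0 size_eq0 => /eqP ->; rewrite cats0.
Qed.

(** The string [s] serves as the address of [phi s]; these embeddings respect directions, and their
    images will be the skew subtrees. *)
Definition branching k phi : Prop :=
  forall s a, size s < k -> prefix (rcons (phi s) a) (phi (rcons s a)).

Variables (k : nat) (phi : T -> T).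
Hypothesis phiP : branching k phi.

Lemma branching_prefix s s' : prefix s s' -> size s' <= k ->
  prefix (phi s) (phi s').
Proof.
case/prefixP=> u ->; elim/last_ind: u => [|u a IH]; first by rewrite cats0 prefix_refl.
rewrite -rcons_cat size_rcons => lek; apply: (prefix_trans (IH (ltnW lek))).
by apply: prefix_trans (@phiP _ a lek); apply: prefix_rcons.
Qed.

Lemma branching_cat r a u : size (r ++ a :: u) <= k ->
  prefix (rcons (phi r) a) (phi (r ++ a :: u)).
Proof.
rewrite -cat_rcons => lek; have lerk: size r < k.
  by apply: leq_trans lek; rewrite size_cat size_rcons leq_addr.
exact: prefix_trans (@phiP _ a lerk) (branching_prefix (prefix_prefix _ _) lek).
Qed.

Lemma branching_size s s' : prefix s s' -> size s < size s' -> size s' <= k ->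
  size (phi s) < size (phi s').
Proof.
case/prefixP=> [[|a u] ->]; first by rewrite cats0 ltnn.
by move=> _ /branching_cat/size_prefix; rewrite size_rcons.
Qed.

(** Addresses that part at [r] have images extending [phi r] by different letters, so no new
    comparabilities arise. *)
Lemma branching_prefixE s s' : size s <= k -> size s' <= k ->
  prefix (phi s) (phi s') = prefix s s'.
Proof.
move=> sk s'k; apply/idP/idP; last by move=> h; apply: branching_prefix.
case: (lcp_decomp s s') => [//|h|[r [a [a' [u [u' [es es' naa']]]]]]] hphi.
  have [lts|] := ltnP (size s') (size s).
    by have := size_prefix hphi; rewrite leqNgt branching_size.
  case/prefixP: h => v ->; rewrite size_cat -{2}(addn0 (size s')) leq_add2l.
  by rewrite leqn0 size_eq0 => /eqP->; rewrite cats0 prefix_refl.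
have h1 : prefix (rcons (phi r) a) (phi s').
  by apply: prefix_trans hphi; rewrite es; apply: branching_cat; rewrite -es.
have: prefix (rcons (phi r) a') (phi s').
  by rewrite es'; apply: branching_cat; rewrite -es'.
move: h1; rewrite !prefixE !size_rcons => /eqP-> /eqP/rcons_inj[eaa'].
by rewrite eaa' eqxx in naa'.
Qed.

Lemma branching_inj s s' : size s <= k -> size s' <= k ->
  phi s = phi s' -> s = s'.
Proof.
move=> sk s'k e; apply: prefix_anti; rewrite -branching_prefixE ?e //;
  exact: prefix_refl.
Qed.

Lemma branching_lex s s' : size s <= k -> size s = size s' ->
  lex_le (phi s) (phi s') = lex_le s s'.
Proof.
move=> sk ess'; have s'k : size s' <= k by rewrite -ess'.
have eqss' : s = s' -> lex_le (phi s) (phi s') = lex_le s s'.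
  by move=> ->; rewrite /lex_le !prefix_refl.
case: (lcp_decomp s s') => [h|h|[r [a [a' [u [u' [es es' naa']]]]]]].
- apply: eqss'; move: h ess'; rewrite prefixE => /eqP h ess'.
  by rewrite -h ess' take_size.
- apply: eqss'; move: h ess'; rewrite prefixE => /eqP h ess'.
  by rewrite -h -ess' take_size.
have := @branching_cat r a u; rewrite -es => /(_ sk)/prefixP[v ->].
have := @branching_cat r a' u'; rewrite -es' => /(_ s'k)/prefixP[v' ->].
by rewrite es es' !cat_rcons !lex_le_diverge.
Qed.

End Embeddings.

(** * Several levels in several trees *)

Section Grid.

Variables (b' : nat) (L : finType) (a0 : L) (Col : finType) (d : nat).
Notation b := b'.+1.
Notation T := (seq 'I_b).
Notation tword := (T -> L).

(** Comparing coordinates first and addresses second covers both length conditions within a level,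
    the one inside a tree and the one between trees. *)
Definition lex_pair (e e' : 'I_d * T) : bool :=
  (e.1 < e'.1) || (e.1 == e'.1) && lex_le e.2 e'.2.

Lemma lex_pair_total : total lex_pair.
Proof.
move=> [i s] [j s']; rewrite /lex_pair /= -!val_eqE /=.
by case: ltngtP => //= _; apply: lex_le_total.
Qed.

Lemma lex_pair_trans : transitive lex_pair.
Proof.
move=> [j s'] [i s] [l s'']; rewrite /lex_pair /=.
case/orP=> [ij|/andP[/eqP-> ss']] /orP[jl|/andP[/eqP<- s's'']].
- by rewrite (ltn_trans ij jl).
- by rewrite ij.
- by rewrite jl.
- by rewrite eqxx (lex_le_trans ss' s's'') orbT.
Qed.

Lemma lex_pair_anti : antisymmetric lex_pair.
Proof.
move=> [i s] [j s']; rewrite /lex_pair /= -!val_eqE /=.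
by case: ltngtP => //= /val_inj -> /lex_le_anti ->.
Qed.

(* Nodes of the subtrees are named by their addresses in the full [b]-ary tree of
   height [k + 1]: [phi i s] is a node if [size s < k] and a leaf if [size s = k],
   and [f i z = inr s] stands for the variable of the node [phi i s]. *)
Definition valid_grid k n (phi : 'I_d -> T -> T) (f : 'I_d -> T -> L + T) : Prop :=
  [/\ forall i, branching k (phi i),
      forall i s, (size s < k -> size (phi i s) < n) /\
                  (size s = k -> size (phi i s) = n),
      forall i s, size s < k -> f i (phi i s) = inr s,
      (forall i z s, f i z = inr s -> size s < k /\ prefix (phi i s) z) /\
      (forall i z, n <= size z -> f i z = inl a0) &
      (forall i j s s', size s = size s' -> size s < k ->
         lex_pair (i, s) (j, s') -> size (phi i s) <= size (phi j s')) /\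
      (forall i j s s', (size s).+1 = size s' -> size s' < k ->
         size (phi i s) < size (phi j s'))].

Definition grid_inst (f : 'I_d -> T -> L + T) (A : 'I_d -> T -> L) (i : 'I_d) : tword :=
  fun z => match f i z with inl a => a | inr s => A i s end.

(** Goodness in terms of addresses: any two leaves are equivalent, a node only to itself with the
    same letter, and the letters elsewhere are free. *)
Definition same_nodes k (A A' : 'I_d -> T -> L) (s s' : 'I_d -> T) : Prop :=
  forall i, (size (s i) == k) && (size (s' i) == k) ||
            [&& size (s i) < k, s i == s' i & A i (s i) == A' i (s' i)].

Lemma supported_grid k n phi f A i :
  valid_grid k n phi f -> supported a0 n (grid_inst f A i).
Proof. by case=> _ _ _ [_ H] _ z /H; rewrite /grid_inst => ->. Qed.

(** Sorting by [lex_pair] turns the bound along the list from [product_stable] into monotonicity in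
    the key. *)
Lemma lex_sorted_exists (E : finType) (key : E -> 'I_d * T) : injective key ->
  exists es : seq E, [/\ uniq es, forall e, e \in es &
    forall h : E -> nat, pairwise (fun e e' => h e <= h e') es ->
    forall e e', lex_pair (key e) (key e') -> h e <= h e'].
Proof.
move=> inj; pose R e e' := lex_pair (key e) (key e').
have totR : total R by move=> e e'; apply: lex_pair_total.
have trR : transitive R by move=> e e' e''; apply: lex_pair_trans.
exists (sort R (enum E)); split.
- by rewrite sort_uniq enum_uniq.
- by move=> e; rewrite mem_sort mem_enum.
move=> h pw e e' Ree'.
have {}Emem x : x \in sort R (enum E) by rewrite mem_sort mem_enum.
have := sort_sorted totR (enum E); rewrite sorted_pairwise // => pwR.
move/(pairwiseP e): pw => pw; move/(pairwiseP e): pwR => pwR.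
have ie := Emem e; have ie' := Emem e'; rewrite -!index_mem in ie ie'.
have [lt|lt|eq] := ltngtP (index e (sort R (enum E))) (index e' (sort R (enum E))).
- by have := pw _ _ ie ie' lt; rewrite !nth_index.
- have := pwR _ _ ie' ie lt; rewrite !nth_index // => Re'e.
  have /inj -> // : key e = key e' by apply: lex_pair_anti; rewrite [lex_pair _ _]Ree'.
by have -> : e = e' by rewrite -(nth_index e (Emem e)) eq nth_index.
Qed.

(* Each coordinate carries a word together with either a node or a leaf, so that
   all partitions of the coordinates are treated at once. *)
Theorem grid_ramsey k (J : finType) : exists n,
  forall c : J -> ('I_d -> tword) -> ('I_d -> T) -> Col,
  exists phi f, valid_grid k n phi f /\
    forall j A A' s s', same_nodes k A A' s s' ->
      c j (grid_inst f A) (fun i => phi i (s i)) =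
      c j (grid_inst f A') (fun i => phi i (s' i)).
Proof.
elim: k J => [|k IH] J.
  exists 0 => c; exists (fun _ _ => [::]), (fun _ _ => inl a0); split=> //.
(* Besides [J], the index records for each coordinate whether its position is a node on the new top
   level, and the letter there. *)
have [n1 H1] := IH (J * {ffun 'I_d -> bool} * {ffun 'I_d -> L})%type.
pose E : finType := ('I_d * n1.-tuple 'I_b)%type.
have injE : injective (fun e : E => (e.1, tval e.2)).
  by move=> [i p] [j q] /= [-> epq]; congr pair; apply: val_inj.
have [es [Ues mem_es sort_es]] := lex_sorted_exists injE.
have [n2 H2] := @product_stable_full b' L a0 Col E es
  (J * {ffun 'I_d -> {ffun n1.-bseq 'I_b -> L}} * {ffun 'I_d -> n1.-bseq 'I_b})%type Ues.
exists (n1 + n2) => c.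
pose ctop (q : J * {ffun 'I_d -> {ffun n1.-bseq 'I_b -> L}} * {ffun 'I_d -> n1.-bseq 'I_b})
    (V : E -> tword) (Y : E -> T) := c q.1.1
  (fun i => glue n1 (of_table a0 (q.1.2 i)) (fun s => V (i, to_tuple n1 s)))
  (fun i => let p := val (q.2 i) in
            if size p < n1 then p else p ++ Y (i, to_tuple n1 p)).
have [D [vD sD gD]] := H2 ctop.
have {}vD e : valid_line a0 n2 (D e) by apply: vD.
have {}sD := sort_es _ sD.
(* All lines above coordinate [i] carry the common letter [q.2 i]; a low leaf is continued to the
   node or in direction 0, according to [q.1.2 i]. *)
pose clow (q : J * {ffun 'I_d -> bool} * {ffun 'I_d -> L})
    (V : 'I_d -> tword) (p : 'I_d -> T) := c q.1.1
  (fun i => glue n1 (V i) (fun s => inst (D (i, to_tuple n1 s)) (q.2 i)))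
  (fun i => if size (p i) < n1 then p i else
     p i ++ pos (D (i, to_tuple n1 (p i))) (if q.1.2 i then None else Some ord0)).
have [phi [f [vG gG]]] := H1 clow.
have [Hbr Hsize Hvar [Hpre Hsupp] [Hlex Hlt]] := vG.
(* Only those nodes of level [n1] that are leaves of the low grid have an address; the lines above
   the others get [a0]. *)
pose owner i p : option (k.-tuple 'I_b) :=
  [pick s : k.-tuple 'I_b | phi i s == p].
have ownerE i s (ss : size s = k) : owner i (phi i s) = Some (to_tuple k s).
  rewrite /owner; case: pickP => [s1 /eqP e|/(_ (to_tuple k s))]; last first.
    by rewrite to_tupleK ?eqxx.
  congr Some; apply: val_inj; rewrite /= to_tupleK //.
  by apply: (branching_inj (Hbr i)) e; rewrite ?size_tuple ?ss.
(* [drop k s] is empty for a new node and holds the direction for a new leaf. *)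
pose psi i s := if size s < k then phi i s else
  let p := phi i (take k s) in p ++ pos (D (i, to_tuple n1 p)) (ohead (drop k s)).
pose g i z := if size z < n1 then f i z else
  match lword (D (i, to_tuple n1 (take n1 z))) (drop n1 z) with
  | Some a => inl a
  | None => if owner i (take n1 z) is Some s then inr (tval s) else inl a0
  end.
pose top A (e : E) : L := if owner e.1 (tval e.2) is Some s then A e.1 (tval s) else a0.
have gE A i : grid_inst g A i = glue n1 (grid_inst f A i)
    (fun s => inst (D (i, to_tuple n1 s)) (top A (i, to_tuple n1 s))).
  apply: functional_extensionality => z; rewrite /grid_inst /glue /g /inst.
  case: ltnP => // lez; case: lword => //=.
  by rewrite /top /= to_tupleK ?size_takel //; case: (owner i _).
have psi_lt i s : size s < k -> psi i s = phi i s by rewrite /psi => ->.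
have psi_eq i s : size s = k ->
    psi i s = phi i s ++ lnode (D (i, to_tuple n1 (phi i s))).
  by move=> ss; rewrite /psi ss ltnn take_oversize ?ss // drop_oversize ?ss.
have psi_rcons i s a : size s = k ->
    psi i (rcons s a) = phi i s ++ lleaf (D (i, to_tuple n1 (phi i s))) a.
  move=> ss; rewrite /psi size_rcons ss ltnNge leqnSn /= -cats1.
  by rewrite take_size_cat // drop_size_cat.
have size_phi i s : size s = k -> size (phi i s) = n1 by case: (Hsize i s).
have le_k s : size s < k.+1 -> size s < k \/ size s = k.
  by rewrite ltnS leq_eqVlt => /orP[/eqP|]; [right|left].
exists psi, g; split.
  split.
  - move=> i s a /le_k[lt|ss]; last first.
      rewrite psi_eq // psi_rcons // rcons_cat prefix_cat2l.
      by have [_ /(_ a)[]] := vD (i, to_tuple n1 (phi i s)).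
    rewrite psi_lt //; have := Hbr i s a lt; move: (lt).
    rewrite -(size_rcons s a) leq_eqVlt => /orP[/eqP ss|lt'].
      by rewrite psi_eq //; apply: prefix_catl.
    by rewrite psi_lt.
  - move=> i s; split=> [/le_k[lt|ss]|].
    + by rewrite psi_lt // (leq_trans (proj1 (Hsize i s) lt)) // leq_addr.
    + rewrite psi_eq // size_cat size_phi // ltn_add2l.
      by have [] := vD (i, to_tuple n1 (phi i s)).
    case/lastP: s => // s a; rewrite size_rcons => -[ss].
    rewrite psi_rcons // size_cat size_phi //.
    by have [_ /(_ a)[-> _]] := vD (i, to_tuple n1 (phi i s)).
  - move=> i s /le_k[lt|ss].
      by rewrite psi_lt // /g (proj1 (Hsize i s) lt) Hvar.
    rewrite psi_eq // /g size_cat size_phi // ltnNge leq_addr /=.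
    rewrite take_size_cat ?size_phi // drop_size_cat ?size_phi //.
    have [_ _ -> _ _] := vD (i, to_tuple n1 (phi i s)).
    by rewrite ownerE //= to_tupleK.
  - split=> [i z s|i z lez]; rewrite /g; last first.
      rewrite ltnNge (leq_trans (leq_addr _ _) lez) /=.
      have [_ _ _ _ ->] // := vD (i, to_tuple n1 (take n1 z)).
      by rewrite size_drop leq_subRL // (leq_trans _ lez) // leq_addr.
    case: ltnP => lez; first by case/Hpre=> lt p; rewrite psi_lt // ltnW.
    case Ew: lword => [//|]; rewrite /owner; case: pickP => // s1 /eqP e [<-].
    rewrite size_tuple; split=> //; rewrite psi_eq ?size_tuple //.
    rewrite -(cat_take_drop n1 z) e prefix_cat2l.
    by have [_ _ _ H _] := vD (i, to_tuple n1 (take n1 z)); apply: H.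
  split=> [i j s s' ess' /le_k[lt|ss] lexss'|i j s s' ess' /le_k[lt|ss]].
  - by rewrite !psi_lt -?ess' //; apply: Hlex.
  - have s's : size s' = k by rewrite -ess'.
    rewrite !psi_eq // !size_cat !size_phi // leq_add2l.
    apply: (sD (i, to_tuple n1 (phi i s)) (j, to_tuple n1 (phi j s'))).
    rewrite /= !to_tupleK ?size_phi //; move: lexss'; rewrite /lex_pair /=.
    case/orP=> [-> //|/andP[/eqP <-]].
    by rewrite (branching_lex (Hbr i)) ?ss // => ->; rewrite eqxx orbT.
  - by rewrite !psi_lt // -?ess' ?Hlt // ltnW // ess'.
  rewrite [psi j s']psi_eq // psi_lt -?ess' //; last by rewrite -ss -ess'.
  rewrite size_cat (size_phi j s') // ltn_addr //; apply: (proj1 (Hsize i s)).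
  by rewrite -ss -ess'.
move=> j.
have colE A s : (forall i, size (s i) <= k.+1) ->
  c j (grid_inst g A) (fun i => psi i (s i)) =
  clow (j, [ffun i => size (s i) == k],
        [ffun i => if size (s i) == k then A i (s i) else a0])
    (grid_inst f A) (fun i => phi i (take k (s i))).
  move=> ss; pose low i := phi i (take k (s i)).
  have size_low i : size (low i) <= n1 /\ (size (low i) < n1) = (size (s i) < k).
    have [lts ges] := Hsize i (take k (s i)).
    have [lt|ge] := ltnP (size (s i)) k.
      have tk : take k (s i) = s i by rewrite take_oversize // ltnW.
      by move: lts; rewrite /low tk => /(_ lt) lt1; rewrite lt1 ltnW.
    by rewrite /low ges ?size_takel // ltnn leqnn.
  (* The node is chosen only in the tree that contains the position; in every other tree some
     direction is chosen, so that its letter may be changed to [beta]. *)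
  pose y (dir : T -> option 'I_b) (e : E) : option 'I_b :=
    if (size (s e.1) == k) && (tval e.2 == low e.1) then None else dir (s e.1).
  have size_p i : size (s i) < k = false -> size (low i) = n1.
    move=> ge; have [lelow] := size_low i; rewrite ge => /negbT; rewrite -leqNgt.
    by move=> gelow; apply/eqP; rewrite eqn_leq lelow.
  pose beta i := if size (s i) == k then A i (s i) else a0.
  have agr (dir dir' : T -> option 'I_b) (e : E) : (forall s, dir s) -> (forall s, dir' s) ->
      agree b (top A e) (beta e.1) (y dir e) (y dir' e).
    move=> hd hd'; rewrite /y; case: ifP => [/andP[/eqP sk /eqP ep]|_].
      rewrite /agree /top /beta sk eqxx ep /low take_oversize ?sk // ownerE //=.
      by rewrite to_tupleK.
    case: (dir _) (hd (s e.1)) => // i _.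
    by case: (dir' _) (hd' (s e.1)) => //= i' _; rewrite !ltn_ord.
  have := gD (j, [ffun i => table n1 (grid_inst f A i)], [ffun i => insubd [bseq] (low i)])
    (top A) (fun e => beta e.1)
    (y (fun s => Some (last ord0 s))) (y (fun=> Some ord0))
    (fun e => agr (fun s => Some (last ord0 s)) (fun=> Some ord0) e
                  (fun=> isT) (fun=> isT)).
  rewrite /ctop /clow /=.
  have tabE i : of_table a0 ([ffun i => table n1 (grid_inst f A i)] i) = grid_inst f A i.
    by rewrite ffunE tableK //; apply: supported_grid vG.
  have lowE i : bseqval ([ffun i => insubd [bseq] (low i) : n1.-bseq 'I_b] i) = low i.
    by rewrite ffunE val_insubd (size_low i).1.
  have posE i (dir : T -> option 'I_b) : size (s i) < k = false ->
      y dir (i, to_tuple n1 (low i)) = if size (s i) == k then None else dir (s i).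
    by move=> ge; rewrite /y /= to_tupleK ?size_p // eqxx andbT.
  move=> H; transitivity (c j
   (fun i => glue n1 (of_table a0 ([ffun i => table n1 (grid_inst f A i)] i))
        (fun s => inst (D (i, to_tuple n1 s)) (top A (i, to_tuple n1 s))))
   (fun i => if size (low i) < n1 then low i else low i ++
       pos (D (i, to_tuple n1 (low i)))
         (y (fun s => Some (last ord0 s)) (i, to_tuple n1 (low i))))).
    congr (c j _ _); apply: functional_extensionality => i; first by rewrite tabE gE.
    rewrite /psi (size_low i).2; case: ifPn => [lt|/negbTE ge].
      by rewrite /low take_oversize // ltnW.
    rewrite -/(low i) posE //; congr (_ ++ pos _ _).
    case: eqP => [sk|/eqP nsk]; first by rewrite drop_oversize ?sk.
    have sk : size (s i) = k.+1.
      apply/eqP; rewrite eqn_leq ss /= ltn_neqAle eq_sym nsk leqNgt.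
      by rewrite ge.
    case/lastP: (s i) sk => // u x; rewrite size_rcons => -[<-].
    by rewrite last_rcons -cats1 drop_size_cat.
  transitivity (c j
   (fun i => glue n1 (of_table a0 ([ffun i => table n1 (grid_inst f A i)] i))
        (fun s => inst (D (i, to_tuple n1 s)) (beta i)))
   (fun i => if size (low i) < n1 then low i else low i ++
       pos (D (i, to_tuple n1 (low i)))
         (y (fun=> Some ord0) (i, to_tuple n1 (low i))))).
    by apply: (etrans _ (etrans H _)); congr (c j _ _);
      apply: functional_extensionality => i; rewrite lowE.
  congr (c j _ _); apply: functional_extensionality => i; rewrite ?tabE ?ffunE //.
  rewrite -/(low i) (size_low i).2; case: ifPn => // /negbTE ge.
  by rewrite posE.
move=> A A' s s' ss'; rewrite !colE; last 2 first.
- by move=> i; case/orP: (ss' i) => [/andP[_ /eqP->]//|/and3P[lt /eqP<- _]]; apply: ltnW.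
- by move=> i; case/orP: (ss' i) => [/andP[/eqP-> _]//|/and3P[lt _ _]]; apply: ltnW.
have sizeE i : (size (s i) == k) = (size (s' i) == k).
  by case/orP: (ss' i) => [/andP[/eqP-> /eqP->]//|/and3P[_ /eqP-> _]].
have -> : [ffun i => size (s i) == k] = [ffun i => size (s' i) == k].
  by apply/ffunP => i; rewrite !ffunE.
have -> : [ffun i => if size (s i) == k then A i (s i) else a0] =
          [ffun i => if size (s' i) == k then A' i (s' i) else a0].
  apply/ffunP => i; rewrite !ffunE -sizeE; case: eqP => // sk.
  case/orP: (ss' i) => [/andP[/eqP sk1 _]|/and3P[_ _ /eqP-> //]].
  by move: sk1; rewrite sk => /eqP; rewrite (ltn_eqF (ltnSn k)).
(* Cut at length [k], new nodes and new leaves both become leaves of the low grid, while old nodes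
   are unchanged. *)
apply: gG => i; case/orP: (ss' i) => [/andP[/eqP sk /eqP s'k]|/and3P[lt /eqP <- /eqP e]].
  by rewrite !size_takel ?sk ?s'k // eqxx.
rewrite ltnS leq_eqVlt in lt; case/orP: lt => [/eqP sk|lt].
  by rewrite size_takel ?sk ?eqxx.
have tk : take k (s i) = s i by rewrite take_oversize // ltnW.
by rewrite tk lt e !eqxx orbT.
Qed.

End Grid.

(** * Images of embeddings are complete skew subtrees *)

Section SkewImage.

Variables (b' k : nat).
Notation b := b'.+1.
Notation T := (seq 'I_b).
Implicit Types (s z u : T) (C : {fset T}).
Variables (phi : T -> T) (S : {fset T}).
Hypothesis phi_branching : branching k phi.
Hypothesis mem_S : forall z, z \in S <-> exists2 s, size s <= k & z = phi s.
Hypothesis size_lex : forall s s', size s = size s' -> size s <= k ->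
  lex_le s s' -> size (phi s) <= size (phi s').
Hypothesis size_step : forall s s', (size s).+1 = size s' -> size s' <= k ->
  size (phi s) < size (phi s').

Lemma phi_in s : size s <= k -> phi s \in S.
Proof. by move=> sk; apply/mem_S; exists s. Qed.

Lemma sprefix_phi s s' : size s <= k -> size s' <= k ->
  sprefix (phi s) (phi s') = sprefix s s'.
Proof.
move=> sk s'k; rewrite /sprefix (branching_prefixE phi_branching) //.
case: (eqVneq s s') => [->|ne]; first by rewrite !eqxx.
case: eqVneq => // /(branching_inj phi_branching sk s'k) e.
by rewrite e eqxx in ne.
Qed.

Lemma sprefix_size s s' : sprefix s s' -> size s < size s'.
Proof.
case/andP=> /prefixP[[|a u] ->]; first by rewrite cats0 eqxx.
by rewrite size_cat /= addnS ltnS leq_addr.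
Qed.

Lemma sprefix_take m s : sprefix (take m s) s = (m < size s).
Proof.
apply/idP/idP => [/sprefix_size|lt].
  by rewrite size_take; case: ifP => // _; rewrite ltnn.
rewrite /sprefix prefix_take /=; apply: contraTneq lt => e.
by rewrite -leqNgt -{1}e size_take_min geq_minl.
Qed.

(** The predecessors of [phi s] are exactly the images of the proper initial segments of [s]. *)
Lemma height_phi s : size s <= k -> height_in S (phi s) = size s.
Proof.
move=> sk; rewrite /height_in.
have tk m : size (take m s) <= k by rewrite size_take_min (leq_trans (geq_minr _ _)).
have -> : pred_in S (phi s) = [fset z in [seq phi (take m s) | m <- iota 0 (size s)]].
  apply/fsetP => z; rewrite !inE /=; apply/andP/mapP => [[/mem_S[s' s'k ->]]|[m]].
    rewrite sprefix_phi // => ps's; exists (size s').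
      by rewrite mem_iota sprefix_size.
    by case/andP: ps's => /prefixP[u ->] _; rewrite take_size_cat.
  rewrite mem_iota add0n => ltm ->.
  by split; [apply: phi_in|rewrite sprefix_phi // sprefix_take].
rewrite card_fseq undup_id ?size_map ?size_iota // map_inj_in_uniq ?iota_uniq //.
move=> m m'; rewrite !mem_iota !add0n /= => lt lt'.
move=> /(branching_inj phi_branching (tk m) (tk m'))/(congr1 size).
by rewrite !size_takel // ltnW.
Qed.

Lemma mem_level m z : (z \in level S m) -> exists s, [/\ size s = m, size s <= k & z = phi s].
Proof.
rewrite !inE /= => /andP[/mem_S[s sk ->]]; rewrite height_phi // => /eqP sm.
by exists s.
Qed.

Lemma size_phi_mono s s' : size s < size s' -> size s' <= k ->
  size (phi s) < size (phi s').
Proof.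
move=> lt s'k; have := size_step (s := s) (s' := take (size s).+1 s').
rewrite size_takel // => /(_ erefl (leq_trans lt s'k)) lt1; apply: leq_trans lt1 _.
by apply/size_prefix/(branching_prefix phi_branching) => //; apply: prefix_take.
Qed.

Lemma prefix_total s s' u : prefix s u -> prefix s' u ->
  prefix s s' || prefix s' s.
Proof.
wlog: s s' / size s <= size s' => [H su s'u|le].
  case/orP: (leq_total (size s) (size s')) => le; first exact: H.
  by rewrite orbC; apply: H.
rewrite !prefixE => /eqP su /eqP s'u; rewrite -{1}s'u take_takel //.
by rewrite su eqxx.
Qed.

(** The longest element of a maximal chain has an address of length [k], as otherwise the image of
    its extension by 0 could be added; the chain then consists of it and all its predecessors. *)
Lemma max_chain_card C : is_max_chain S C -> #|` C| = k.+1.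
Proof.
case=> CS chC maxC.
have extend s : size s <= k -> (forall z, z \in C -> prefix z (phi s)) -> phi s \in C.
  move=> sk Cs; rewrite -[C](maxC (phi s |` C)) ?fset1U1 ?fsubsetUr //.
    by apply/fsubsetP => z /fset1UP[->|/(fsubsetP CS)//]; apply: phi_in.
  move=> z z' /fset1UP[->|zC] /fset1UP[->|z'C]; first by rewrite prefix_refl.
  - by rewrite (Cs _ z'C) orbT.
  - by rewrite (Cs _ zC).
  - exact: chC.
have [z0 z0C] : exists z, z \in C.
  have [C0|/fset0Pn[z zC]] := eqVneq C fset0; last by exists z.
  by exists (phi [::]); apply: extend => // z; rewrite C0 inE.
pose top := val [arg max_(z > FSetSub z0C) size (val z)].
have topC : top \in C by apply: valP.
have top_max z : z \in C -> prefix z top.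
  move=> zC; have le : size z <= size top.
    rewrite /top; case: arg_maxnP => //= t _ /(_ (FSetSub zC) isT) /=.
    by [].
  case/orP: (chC _ _ zC topC) => // pt.
  by move: le; case/prefixP: pt => u ->; rewrite size_cat -{2}(addn0 (size top))
    leq_add2l leqn0 size_eq0 => /eqP->; rewrite cats0 prefix_refl.
have /mem_S[s sk es] : top \in S by apply: (fsubsetP CS).
have {sk} ss : size s = k.
  move: sk; rewrite leq_eqVlt => /orP[/eqP//|lt].
  have lt' : size (rcons s ord0) <= k by rewrite size_rcons.
  have /top_max : phi (rcons s ord0) \in C.
    apply: extend => // z /top_max pz; apply: prefix_trans pz _.
    by rewrite es; apply: (branching_prefix phi_branching) => //; apply: prefix_rcons.
  by move/size_prefix; rewrite es leqNgt size_phi_mono // size_rcons.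
have sk : size s <= k by rewrite ss.
have eC : phi s |` pred_in S (phi s) = C.
  apply: maxC.
  - apply/fsubsetP => z /fset1UP[->|]; first exact: phi_in.
    by rewrite !inE => /andP[].
  - have H z : z \in phi s |` pred_in S (phi s) -> prefix z (phi s).
      by case/fset1UP=> [->|]; rewrite ?prefix_refl // !inE => /and3P[].
    by move=> z z' /H zs /H z's; apply: prefix_total zs z's.
  apply/fsubsetP => z zC; rewrite !inE -es -topredE /=.
  case: (eqVneq z top) => //= ne; apply/andP; split; first exact: (fsubsetP CS).
  by rewrite /sprefix top_max.
rewrite -eC cardfsU1 -/(height_in S (phi s)) height_phi // ss.
by rewrite !inE /sprefix eqxx !andbF.
Qed.

Lemma complete_skew_phi : complete_skew k.+1 S.
Proof.
split.
- split; last exact: max_chain_card.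
  exists (phi [::]); first exact: phi_in.
  by move=> z /mem_S[s sk ->]; apply: (branching_prefix phi_branching); rewrite ?prefix0s.
- move=> z z' /mem_S[s sk ->] /mem_S[s' s'k ->]; rewrite !height_phi // => ss'.
  by rewrite (branching_lex phi_branching) //; apply: size_lex.
- move=> z z' /mem_S[s sk ->] /mem_S[s' s'k ->]; rewrite !height_phi // => lt.
  exact: size_phi_mono.
move=> _ /mem_S[s sk ->] [u /mem_S[s' s'k ->]]; rewrite sprefix_phi // => ss' i.
have lt : size s < k by apply: leq_trans (sprefix_size ss') s'k.
have sik : size (rcons s i) <= k by rewrite size_rcons.
have above t : size t <= k -> sprefix s t -> prefix (rcons (phi s) i) (phi t) ->
    prefix (rcons s i) t.
  move=> tk /andP[/prefixP[[|a v] et]]; first by rewrite et cats0 eqxx.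
  rewrite {}et in tk *; move=> _ pi; have := branching_cat phi_branching tk; move: pi.
  rewrite !prefixE !size_rcons => /eqP-> /eqP/rcons_inj[<-].
  by rewrite -cat_rcons take_size_cat ?size_rcons.
have si : sprefix s (rcons s i).
  rewrite /sprefix prefix_rcons; apply/eqP => /(congr1 size)/eqP.
  by rewrite size_rcons ltn_eqF.
exists (phi (rcons s i)); split.
  split; last exact: phi_branching.
  rewrite !inE /= phi_in // sprefix_phi // si /=; apply/hasPn => y.
  case/mem_S=> t tk ->; rewrite !sprefix_phi //; apply/negP => /andP[st ti].
  by have := sprefix_size ti; rewrite size_rcons ltnS leqNgt (sprefix_size st).
(* An immediate successor in direction [i] lies at or above [phi (rcons s i)], which cannot lie
   strictly between. *)
move=> y [yS py]; move: yS py; rewrite !inE /= => /and3P[/mem_S[t tk ->]].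
rewrite sprefix_phi // => st /hasPn noz pt; congr phi.
have := noz (phi (rcons s i)) (phi_in sik); rewrite !sprefix_phi // si /=.
by rewrite /sprefix (above t) //= negbK => /eqP.
Qed.

End SkewImage.

(** Leaves are padded by zeros up to length [n]; nodes keep their lengths below [n0]. *)
Lemma grid_ramsey_ge b' (L : finType) (a0 : L) (Col : finType) d k (J : finType) :
  exists n0, forall n, n0 <= n ->
  forall c : J -> ('I_d -> seq 'I_b'.+1 -> L) -> ('I_d -> seq 'I_b'.+1) -> Col,
  exists phi f, valid_grid a0 k n phi f /\
    forall j A A' s s', same_nodes k A A' s s' ->
      c j (grid_inst f A) (fun i => phi i (s i)) =
      c j (grid_inst f A') (fun i => phi i (s' i)).
Proof.
have [n0 H0] := @grid_ramsey b' L a0 Col d k J; exists n0 => n len c.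
have [phi [f [vG gG]]] := H0 (fun j W y => c j W (fun i => pad n0 (n - n0) (y i))).
exists (fun i s => pad n0 (n - n0) (phi i s)), f; split=> //.
have [Hbr Hsize Hvar [Hpre Hsupp] [Hlex Hlt]] := vG.
have pad_lt i s : size s < k -> pad n0 (n - n0) (phi i s) = phi i s.
  by move=> /(proj1 (Hsize i s)) lt; rewrite /pad ltn_eqF.
have prefix_pad z : prefix z (pad n0 (n - n0) z).
  by rewrite /pad; case: ifP => _; rewrite ?prefix_prefix ?prefix_refl.
split.
- move=> i s a lt; rewrite (pad_lt i s lt).
  by apply: prefix_trans (Hbr i s a lt) _.
- move=> i s; split=> [lt|ss].
    by rewrite pad_lt // (leq_trans (proj1 (Hsize i s) lt)).
  by rewrite /pad (proj2 (Hsize i s) ss) eqxx size_cat size_nseq (proj2 (Hsize i s) ss) subnKC.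
- by move=> i s lt; rewrite pad_lt // Hvar.
- split=> [i z s /Hpre[lt p]|i z lez]; first by rewrite pad_lt.
  by rewrite Hsupp // (leq_trans len).
split=> i j s s' ss' lt.
  by rewrite !pad_lt -?ss' //; apply: Hlex.
by rewrite !pad_lt //; [apply: Hlt | rewrite ltnW // ss'].
Qed.

(** * From grids to variable words and their subspaces *)

Section Conversion.

Variables (b' n d k : nat) (L Lambda : finType) (a0 : L).
Notation b := b'.+1.
Notation T := (seq 'I_b).
Variables (g : L -> Lambda) (g' : Lambda -> L).
Hypotheses (g'K : cancel g' g) (gK : cancel g g').
Hypotheses (n_gt0 : 0 < n) (k_gt0 : 0 < k).
Variables (phi : 'I_d -> T -> T) (f : 'I_d -> T -> L + T).
Hypothesis gridP : valid_grid a0 k n phi f.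
Variables (D0 D1 D2 : {set 'I_d}).

Definition root_node : node b n := exist _ [bseq] n_gt0.

Definition node_of (z : T) : node b n := insubd root_node (insubd [bseq] z : n.-bseq 'I_b).

Lemma node_ofK z : size z < n -> node_seq (node_of z) = z.
Proof.
move=> lt; have ez : bseqval (insubd [bseq] z : n.-bseq 'I_b) = z.
  by rewrite val_insubd ltnW.
by rewrite /node_seq /node_of val_insubd ez lt.
Qed.

Lemma node_seq_inj : injective (@node_seq b n).
Proof. by move=> s t e; apply/val_inj/val_inj. Qed.

Lemma node_seqK t : node_of (node_seq t) = t.
Proof. by apply: node_seq_inj; rewrite node_ofK //; case: t. Qed.

Definition pre_of (i : 'I_d) : preword b n Lambda :=
  [ffun t => match f i (node_seq t) with
             | inl a => inl (g a)
             | inr s => inr (node_of (phi i s))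
             end].

Definition leaves_of (i : 'I_d) : {set n.-tuple 'I_b} :=
  [set to_tuple n (phi i (tval s)) | s : k.-tuple 'I_b].

Definition mixed_of : mixed_preword b n Lambda D1 :=
  ([ffun i => pre_of i], [ffun i => leaves_of (val i)]).

Lemma mem_ws_pre i z : z \in ws (pre_of i) <-> exists2 s, size s < k & z = phi i s.
Proof.
have [_ Hsize Hvar [Hpre _] _] := gridP.
split=> [/imfsetP[t /= /existsP[u /eqP]]|[s sk ->]].
  rewrite ffunE; case Ef: (f i _) => [//|s] [<-] ->; have [sk _] := Hpre _ _ _ Ef.
  by exists s => //; rewrite node_ofK //; apply: (proj1 (Hsize i s)).
have lt := proj1 (Hsize i s) sk.
rewrite -(node_ofK lt); apply/mem_ws; exists (node_of (phi i s)).
by rewrite ffunE node_ofK // Hvar.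
Qed.

Lemma mem_leaves i x : x \in leaves_of i <->
  exists2 s, size s = k & tval x = phi i s.
Proof.
have [_ Hsize _ _ _] := gridP.
split=> [/imsetP[s _ ->]|[s ss ex]].
  exists s; rewrite ?size_tuple // to_tupleK //.
  by apply: (proj2 (Hsize i s)); rewrite size_tuple.
apply/imsetP; exists (to_tuple k s) => //.
by apply: val_inj; rewrite /= !to_tupleK // -ex size_tuple.
Qed.

(** The bound on nodes extends to leaves because all leaves have length [n]. *)
Lemma size_grid_lex i j s s' : size s = size s' -> size s <= k ->
  lex_pair (i, s) (j, s') -> size (phi i s) <= size (phi j s').
Proof.
have [_ Hsize _ _ [Hlex _]] := gridP => ss'.
rewrite leq_eqVlt => /orP[/eqP sk _|sk]; last exact: Hlex.
by rewrite (proj2 (Hsize i s) sk) (proj2 (Hsize j s')) // -ss'.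
Qed.

Lemma size_grid_step i j s s' : (size s).+1 = size s' -> size s' <= k ->
  size (phi i s) < size (phi j s').
Proof.
have [_ Hsize _ _ [_ Hlt]] := gridP => ss'.
rewrite leq_eqVlt => /orP[/eqP sk|sk]; last exact: Hlt.
by rewrite (proj2 (Hsize j s') sk) (proj1 (Hsize i s)) // ss' sk.
Qed.

Lemma lex_pair_diag (i : 'I_d) (s s' : T) : lex_le s s' -> lex_pair (i, s) (i, s').
Proof. by rewrite /lex_pair /= eqxx => ->; rewrite orbT. Qed.

Lemma branching_grid m i : m <= k -> branching m (phi i).
Proof.
by move=> mk s a lt; have [Hbr _ _ _ _] := gridP; apply: Hbr; apply: leq_trans mk.
Qed.

Lemma le_pred (s : T) : (size s <= k.-1) = (size s < k).
Proof. by rewrite -ltnS prednK. Qed.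

Lemma mem_ws_pred i z : z \in ws (pre_of i) <-> exists2 s, size s <= k.-1 & z = phi i s.
Proof.
by split=> [/mem_ws_pre|] [s sk ->]; [exists s|apply/mem_ws_pre; exists s];
  rewrite // ?le_pred // -le_pred.
Qed.

Lemma complete_skew_ws i : complete_skew_lt k n (ws (pre_of i)).
Proof.
split.
  (* Without the leaves the addresses have length at most [k.-1], which gives height [k]. *)
  rewrite -{1}(prednK k_gt0); apply: (complete_skew_phi (phi := phi i)).
  - exact/branching_grid/leq_pred.
  - exact: mem_ws_pred.
  - move=> s s' ss' sk /(lex_pair_diag i); apply: size_grid_lex => //.
    exact: leq_trans sk (leq_pred k).
  - by move=> s s' ss' sk; apply: size_grid_step => //; apply: leq_trans sk (leq_pred k).
move=> z /mem_ws_pre[s sk ->].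
by have [_ Hsize _ _ _] := gridP; apply: (proj1 (Hsize i s)).
Qed.

Lemma level_ws i m z : z \in level (ws (pre_of i)) m ->
  exists s, [/\ size s = m, size s < k & z = phi i s].
Proof.
case/(mem_level (branching_grid i (leq_pred k)) (@mem_ws_pred i)) => s [sm sk ->].
by exists s; rewrite -le_pred.
Qed.

Lemma mixed_of_valid : mixed_variable_word k mixed_of.
Proof.
have [Hbr Hsize Hvar [Hpre _] _] := gridP.
split=> [i||i] /=; rewrite ?ffunE.
- split; first exact: complete_skew_ws.
    move=> s t; rewrite ffunE; case Ef: (f i _) => [//|r] [<-].
    have [rk _] := Hpre _ _ _ Ef; apply/mem_ws_pre; exists r => //.
    by rewrite node_ofK //; apply: (proj1 (Hsize i r)).
  move=> t /mem_ws_pre[r rk et]; split.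
    by rewrite ffunE et Hvar // -et node_seqK.
  move=> s; rewrite ffunE; case Ef: (f i _) => [//|r'] [<-].
  have [rk' pr] := Hpre _ _ _ Ef.
  by rewrite node_ofK //; apply: (proj1 (Hsize i r')).
- split=> [i|i j m si sj ij mk|i j m si sj mk]; rewrite ?ffunE.
  + exact: complete_skew_ws.
  + case/level_ws=> s [sm sk ->] /level_ws[s' [s'm _ ->]].
    by apply: size_grid_lex; rewrite ?sm ?(ltnW mk) // /lex_pair /= ij.
  case/level_ws=> s [sm sk ->] /level_ws[s' [s'm s'k ->]].
  by apply: size_grid_step; rewrite ?sm ?s'm // ltnW.
split.
  rewrite card_imset ?card_tuple ?card_ord // => s s' /(congr1 (@tval _ _)).
  rewrite !to_tupleK ?(proj2 (Hsize _ _)) ?size_tuple // => e.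
  by apply: val_inj; apply: (branching_inj (Hbr (val i))) e; rewrite size_tuple.
split; last first.
  move=> z; rewrite in_fsetU => /orP[/mem_ws_pre[s sk ->]|].
    by rewrite ltnW // (proj1 (Hsize _ s)).
  by case/imfsetP=> x _ ->; rewrite size_tuple.
(* With the leaves all addresses of length at most [k] occur, which gives height [k.+1]. *)
apply: (complete_skew_phi (phi := phi (val i))) => //.
- move=> z; rewrite in_fsetU; split.
    case/orP=> [/mem_ws_pre[s sk ->]|]; first by exists s => //; apply: ltnW.
    case/imfsetP=> x /= /mem_leaves[s sk ->] ->.
    by exists s => //; rewrite sk.
  case=> s; rewrite leq_eqVlt => /orP[/eqP sk|sk] ->; apply/orP.
    right; apply/imfsetP; exists (to_tuple n (phi (val i) s)) => /=.
      by apply/mem_leaves; exists s => //; apply: to_tupleK; apply: (proj2 (Hsize _ s)).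
    by rewrite to_tupleK //; apply: (proj2 (Hsize _ s)).
  by left; apply/mem_ws_pre; exists s.
- by move=> s s' ss' sk /(lex_pair_diag (val i)); apply: size_grid_lex.
- by move=> s s' ss' sk; apply: size_grid_step.
Qed.

(** One family of positions serves every partition: in [D1] a position is read as a leaf, in [D2] as
    a node. *)
Definition pack (W : 'I_d -> T -> L) (y : 'I_d -> T) : mixed_word b n Lambda D1 D2 :=
  ([ffun i => [ffun t => g (W i (node_seq t))]],
   [ffun i => to_tuple n (y (val i))],
   [ffun i => node_of (y (val i))]).

Lemma span_address p : partition3 D0 D1 D2 -> mixed_span mixed_of p ->
  exists A s, [/\ p = pack (grid_inst f A) (fun i => phi i (s i)),
    forall i, i \notin D2 -> size (s i) = k &
    forall (i : {i | i \in D2}), [/\ size (s (val i)) < k,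
      node_seq (p.2 i) = phi (val i) (s (val i)) &
      p.1.1 (val i) (p.2 i) = g (A (val i) (s (val i)))]].
Proof.
have [Hbr Hsize Hvar [Hpre _] _] := gridP.
case: p => [[w x] t] /and4P[_ _ _ dis12] [Hw Hx Ht].
have /fin_all_exists[al Hal] : forall i, exists al, w i = subst_word (pre_of i) al.
  by move=> i; have [al ->] := Hw i; exists al; rewrite ffunE.
have /fin_all_exists[s Hs] : forall i, exists si : T,
    [/\ forall h : i \in D1, size si = k /\ tval (x (exist _ i h)) = phi i si,
        forall h : i \in D2, size si < k /\ node_seq (t (exist _ i h)) = phi i si &
        i \notin D2 -> size si = k].
  move=> i; have [i2|ni2] := orP (orbN (i \in D2)).
    have := Ht (exist _ i i2); rewrite /= ffunE => /mem_ws_pre[si sk ei].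
    exists si; split=> h; last by rewrite i2 in h.
      by have /= := disjointFr dis12 h; rewrite i2.
    by rewrite (bool_irrelevance h i2).
  have [i1|ni1] := orP (orbN (i \in D1)); last first.
    (* A coordinate of [D0] has no position and gets an arbitrary leaf. *)
    exists (nseq k ord0); split=> h; last by rewrite size_nseq.
      by rewrite h in ni1.
    by rewrite h in ni2.
  have := Hx (exist _ i i1); rewrite ffunE => /mem_leaves[si sk ei].
  exists si; split=> // h; first by rewrite (bool_irrelevance h i1).
  by move: ni2; rewrite h.
exists (fun i r => g' (al i (node_of (phi i r)))), s; split.
- rewrite /pack; congr (_, _, _); apply/ffunP => i; rewrite !ffunE.
  + apply/ffunP => z; rewrite Hal !ffunE /grid_inst.
    by case: (f i _) => // r; rewrite g'K.
  + case: i => i h; have [/(_ h)[sk ex] _ _] := Hs i; apply: val_inj.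
    by rewrite /= ex to_tupleK //; apply: (proj2 (Hsize _ _)).
  case: i => i h; have [_ /(_ h)[sk et] _] := Hs i; apply: node_seq_inj.
  by rewrite et node_ofK //; apply: (proj1 (Hsize _ _)).
- by move=> i ni; have [_ _ ->] := Hs i.
case=> i h /=; have [_ /(_ h)[sk et] _] := Hs i; split=> //.
by rewrite Hal !ffunE et Hvar //= g'K.
Qed.

(** Outside [D2] all addresses are leaves, hence equivalent; in [D2] equal nodes have equal
    addresses by injectivity, and equal letters pull back along [g]. *)
Lemma mixed_of_good (Col : Type) (c : mixed_word b n Lambda D1 D2 -> Col) :
  partition3 D0 D1 D2 ->
  (forall A A' s s', same_nodes k A A' s s' ->
     c (pack (grid_inst f A) (fun i => phi i (s i))) =
     c (pack (grid_inst f A') (fun i => phi i (s' i)))) ->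
  good c mixed_of.
Proof.
move=> part gG p p' /(span_address part)[A [s [ep Hl Hn]]].
move=> /(span_address part)[A' [s' [ep' Hl' Hn']]].
have [Hbr _ _ _ _] := gridP.
case: p p' ep ep' Hn Hn' => [[w x] t] [[w' x'] t'] /= -> -> Hn Hn' tt'.
apply: gG => i; have [i2|ni2] := boolP (i \in D2); last first.
  by rewrite Hl // Hl' // eqxx.
have [sk et ew] := Hn (exist _ i i2); have [s'k et' ew'] := Hn' (exist _ i i2).
have [ett eww] := tt' (exist _ i i2); rewrite /= in sk et ew s'k et' ew' ett eww.
have ess : s i = s' i.
  apply: (branching_inj (Hbr i)); rewrite ?(ltnW sk) ?(ltnW s'k) //.
  by rewrite -et -et' ett.
apply/orP; right; rewrite sk ess eqxx /= -(inj_eq (can_inj gK)) -ess.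
by rewrite -ew ess -ew' eww.
Qed.

End Conversion.

Theorem theorem13 (d0 d1 d2 : nat) (hd : 0 < d0 + d1 + d2)
    (b l k r : nat) (hb : 0 < b) (hl : 0 < l) (hk : 0 < k) (hr : 0 < r) :
  exists n0 : nat, 0 < n0 /\
    forall (Lambda : finType), #|Lambda| = l ->
    forall n : nat, n0 <= n ->
    forall D0 D1 D2 : {set 'I_(d0 + d1 + d2)},
      partition3 D0 D1 D2 -> #|D0| = d0 -> #|D1| = d1 -> #|D2| = d2 ->
    forall (Col : finType), #|Col| = r ->
    forall c : mixed_word b n Lambda D1 D2 -> Col,
    exists F : mixed_preword b n Lambda D1,
      mixed_variable_word k F /\ good c F.
Proof.
case: b hb => // b' _.
(* The bound precedes the alphabet and the colour set, so the grid theorem is applied to ['I_l] and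
   ['I_r]; the default letter is 0, available as [0 < l]. *)
have [n0 H0] := grid_ramsey_ge b' (Ordinal hl) 'I_r (d0 + d1 + d2) k unit.
(* The successor makes [n] positive, so that the root is a node. *)
exists n0.+1; split=> // Lambda eL n len D0 D1 D2 part _ _ _ Col eC c.
pose g (a : 'I_l) : Lambda := enum_val (cast_ord (esym eL) a).
pose g' (x : Lambda) : 'I_l := cast_ord eL (enum_rank x).
have gK : cancel g g' by move=> a; rewrite /g' /g enum_valK cast_ordKV.
have g'K : cancel g' g by move=> x; rewrite /g' /g cast_ordK enum_rankK.
have n_gt0 : 0 < n := leq_trans (ltn0Sn n0) len.
have [phi [f [vG gG]]] := H0 n (ltnW len) (fun _ W y =>
  cast_ord eC (enum_rank (c (pack g n_gt0 D1 D2 W y)))).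
exists (mixed_of k g n_gt0 phi f D1); split.
  exact: (mixed_of_valid g n_gt0 hk vG).
apply: (mixed_of_good g'K gK vG part) => A A' s s' /(gG tt).
by move/cast_ord_inj/enum_rank_inj.
Qed.
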